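(* Let $\mathbf w=w_0w_1w_2\cdots$ be an automatic (resp. morphic) infinite word over $\{0,1,\ldots,b-1\}$ (with $b\ge2$) that has no suffix of the form $0^\omega$ and contains infinitely many maximal zero blocks. For $k\ge0$ let $(i_k,j_k)$ be the starting and ending positions of the $k$-th maximal zero block of $\mathbf w$. Then $\limsup_{k\to\infty} j_k/i_k$ is finite and rational (resp. algebraic).
   Context: Positions in infinite words are indexed from $0$. For $0\le i\le j$, $w_i\cdots w_j$ is a maximal zero block of $\mathbf w$ if $w_i=\cdots=w_j=0$, $w_{j+1}\ne0$, and either $i=0$ or $w_{i-1}\ne0$; maximal zero blocks are enumerated in increasing order of position. Morphic/automatic words: Let $\Sigma$ be a finite alphabet. A morphism $h:\Sigma^*\to\Sigma^*$ is prolongable on $a\in\Sigma$ if $h(a)=ax$ with $x\in\Sigma^+$ and $h^n(x)$ nonempty for all $n\ge0$; then $h^n(a)$ converges to the infinite word $h^\omega(a)=a\,x\,h(x)\,h^2(x)\cdots$, called a pure morphic word. A coding is a letter-to-letter morphism. An infinite word is morphic if it is the image under a coding of a pure morphic word, and automatic if it is the image under a coding of a pure morphic word $h^\omega(a)$ with $h$ uniform (all $|h(c)|$ equal). *)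

(* Defs.v *)
From Stdlib Require Import Reals ZArith List Arith.
Import ListNotations.
Open Scope R_scope.

(* Infinite words are functions nat -> nat (positions indexed from 0).
   A finite alphabet of size m is represented as {0, ..., m-1}. *)

Definition morph_ext (h : nat -> list nat) (l : list nat) : list nat :=
  flat_map h l.

Definition morph_iter (h : nat -> list nat) (n : nat) (l : list nat) : list nat :=
  Nat.iter n (morph_ext h) l.

Definition is_morphism_on (m : nat) (h : nat -> list nat) : Prop :=
  forall c, (c < m)%nat -> Forall (fun d => (d < m)%nat) (h c).

Definition prolongable (h : nat -> list nat) (a : nat) : Prop :=
  exists x : list nat, h a = a :: x /\ x <> [] /\
    forall n, morph_iter h n x <> [].

(* u = h^omega(a): u is the limit of h^n(a), i.e. each h^n(a) is a prefix of u. *)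
Definition is_fixed_point_word (h : nat -> list nat) (a : nat) (u : nat -> nat) : Prop :=
  forall n i, (i < length (morph_iter h n [a]))%nat ->
    u i = nth i (morph_iter h n [a]) 0%nat.

Definition uniform_on (m : nat) (h : nat -> list nat) : Prop :=
  exists q, forall c, (c < m)%nat -> length (h c) = q.

Definition morphic (w : nat -> nat) : Prop :=
  exists (m : nat) (h : nat -> list nat) (a : nat) (u : nat -> nat) (tau : nat -> nat),
    (a < m)%nat /\ is_morphism_on m h /\ prolongable h a /\
    is_fixed_point_word h a u /\ forall k, w k = tau (u k).

Definition automatic (w : nat -> nat) : Prop :=
  exists (m : nat) (h : nat -> list nat) (a : nat) (u : nat -> nat) (tau : nat -> nat),
    (a < m)%nat /\ is_morphism_on m h /\ uniform_on m h /\ prolongable h a /\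
    is_fixed_point_word h a u /\ forall k, w k = tau (u k).

Definition word_over (b : nat) (w : nat -> nat) : Prop := forall k, (w k < b)%nat.

Definition no_zero_tail (w : nat -> nat) : Prop :=
  forall n, exists k, (n <= k)%nat /\ w k <> 0%nat.

Definition max_zero_block (w : nat -> nat) (i j : nat) : Prop :=
  (i <= j)%nat /\ (forall t, (i <= t <= j)%nat -> w t = 0%nat) /\
  w (S j) <> 0%nat /\ (i = 0%nat \/ w (Nat.pred i) <> 0%nat).

Definition infinitely_many_max_zero_blocks (w : nat -> nat) : Prop :=
  forall n, exists i j, (n <= i)%nat /\ max_zero_block w i j.

Definition enumerates_max_zero_blocks (w : nat -> nat) (I J : nat -> nat) : Prop :=
  (forall k, max_zero_block w (I k) (J k)) /\
  (forall k, (I k < I (S k))%nat) /\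
  (forall i j, max_zero_block w i j -> exists k, I k = i /\ J k = j).

Definition is_limsup (s : nat -> R) (L : R) : Prop :=
  (forall eps, eps > 0 -> exists N, forall k, (N <= k)%nat -> s k < L + eps) /\
  (forall eps, eps > 0 -> forall N, exists k, (N <= k)%nat /\ s k > L - eps).

Definition is_rational (x : R) : Prop :=
  exists p q : Z, q <> 0%Z /\ x = IZR p / IZR q.

Definition zpoly_eval (cs : list Z) (x : R) : R :=
  fold_right (fun c acc => IZR c + x * acc) 0 cs.

Definition is_algebraic (x : R) : Prop :=
  exists cs : list Z, Exists (fun c => c <> 0%Z) cs /\ zpoly_eval cs x = 0.

(* Main.v *)
(* Replace the morphism by a power g such that the set of letters of g^n(c) does not depend
   on n >= 1, and call c alive when g(c) contains a letter coded by a nonzero digit. Up to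
   bounded errors the long zero blocks are the gaps between consecutive alive positions of the
   fixed point, and g maps such a gap (s,t) to a gap (phi s, psi t). Every gap is the n-th image
   of a gap born inside a single g(u_r); the n-th images of equal letter patterns have equal
   lengths, so for the ratio t/s only the leftmost occurrence of each of the finitely many
   patterns matters. The limsup is thus 1 or the limsup of psi^n(t)/phi^n(s) for one of
   finitely many gaps (s,t).
   Both sequences are lengths |G^n(W)| for a morphism G on a marked alphabet. After passing to a
   power of G, the only eigenvalue of largest modulus is a positive real lambda, so that
   |G^n(W)| = lambda^n P(n) + O(theta^n) with theta < lambda and P a polynomial with algebraic
   coefficients: ratios of two such sequences converge to algebraic numbers along residue
   classes. In the uniform case the recurrences are X -> q X + const along residue classes, and
   the limits are rational. *)
From HB Require Import structures.
From mathcomp Require all_boot all_order all_algebra all_field.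
From mathcomp Require zify ring boolp Rstruct.
Require Defs.
From Stdlib Require Reals Lra ZArith List Arith.

(** * Linear recurrences over the algebraic numbers *)

Module ExponentialPolynomials.
Import all_boot all_order all_algebra all_field.
Import ring.
Set Implicit Arguments. Unset Strict Implicit. Unset Printing Implicit Defensive.
Import Order.TTheory GRing.Theory Num.Theory.
Local Open Scope ring_scope.

(** * Limits in numeric fields *)

Section Tends.
Variable K : numFieldType.
Implicit Types (y f : nat -> K) (z l k : K).

(** One notion of limit serves both [algC] and the reals: in [algC], [0 < e] already forces [e] to
    be a positive real. *)
Definition tends y l :=
  forall e, 0 < e -> exists N, forall n, (N <= n)%N -> `|y n - l| <= e.

Lemma tends_ext y f l N : (forall n, (N <= n)%N -> y n = f n) -> tends y l -> tends f l.
Proof.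
move=> yf yl e /yl[M MP]; exists (maxn N M) => n.
by rewrite geq_max => /andP[Nn Mn]; rewrite -yf // MP.
Qed.

Lemma tends_cst l : tends (fun=> l) l.
Proof. by move=> e e0; exists 0%N => n _; rewrite subrr normr0 ltW. Qed.

Lemma tendsD y f l k : tends y l -> tends f k -> tends (fun n => y n + f n) (l + k).
Proof.
move=> yl fk e e0; have e2 : 0 < e / 2%:R by rewrite divr_gt0 // ltr0n.
have [N NP] := yl _ e2; have [M MP] := fk _ e2.
exists (maxn N M) => n; rewrite geq_max => /andP[Nn Mn].
rewrite opprD addrACA; apply: le_trans (ler_normD _ _) _.
apply: le_trans (lerD (NP n Nn) (MP n Mn)) _.
by rewrite -splitr.
Qed.

Lemma tends0_le y f C : tends f 0 -> (forall n, `|y n| <= C * `|f n|) -> tends y 0.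
Proof.
move=> f0 yf e e0.
have C1 : 0 < `|C| + 1 by rewrite ltr_wpDl.
have [N NP] := f0 (e / (`|C| + 1)) (divr_gt0 e0 C1).
exists N => n /NP; rewrite !subr0 ler_pdivlMr // => fe.
have C0 : 0 <= C * `|f n| := le_trans (normr_ge0 _) (yf n).
apply: le_trans (yf n) _; rewrite -(ger0_norm C0).
rewrite normrM normr_id mulrC; apply: le_trans fe.
by rewrite ler_wpM2l // lerDl.
Qed.

Lemma tends_sub0 y l : tends y l <-> tends (fun n => y n - l) 0.
Proof.
by split=> H e /H[N NP]; exists N => n /NP; rewrite subr0.
Qed.

Lemma tends0Ml y z : tends y 0 -> tends (fun n => z * y n) 0.
Proof. by move=> y0; apply: (tends0_le (C := `|z|) y0) => n; rewrite normrM. Qed.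

Lemma tendsM y f l k : tends y l -> tends f k -> tends (fun n => y n * f n) (l * k).
Proof.
move=> yl fk.
have [N NP] := fk _ ltr01.
have h1 : tends (fun n => (y n - l) * f n) 0.
  have b n : (N <= n)%N -> `|f n| <= `|k| + 1.
    move=> Nn; rewrite -[f n](subrK k) addrC.
    by apply: le_trans (ler_normD _ _) _; rewrite lerD2l NP.
  apply: (@tends_ext (fun n => if (N <= n)%N then (y n - l) * f n else 0) _ _ N).
    by move=> n ->.
  apply: (tends0_le (C := `|k| + 1) (f := fun n => y n - l)).
    exact: (tends_sub0 _ _).1 yl.
  move=> n; case: ifP => [Nn|_].
    by rewrite normrM mulrC ler_wpM2r // b.
  by rewrite normr0 mulr_ge0 // addr_ge0.
have h2 : tends (fun n => l * (f n - k)) 0 by apply: tends0Ml; exact: (tends_sub0 _ _).1 fk.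
apply: (tends_sub0 _ _).2; move: (tendsD h1 h2); rewrite addr0.
by apply: (@tends_ext _ _ _ 0) => n _; ring.
Qed.

Lemma tends_unique y l k : tends y l -> tends y k -> l = k.
Proof.
move=> yl yk; apply/eqP; rewrite -subr_eq0 -normr_le0.
apply/negPn/negP => h.
have e0 : 0 < `|l - k| by rewrite lt_def normr_ge0 andbT; apply: contra h => /eqP->.
have e3 : 0 < `|l - k| / 3%:R by rewrite divr_gt0 // ltr0n.
have [N NP] := yl _ e3; have [M MP] := yk _ e3.
have := ler_distD (y (maxn N M)) l k.
rewrite [`|l - y _|]distrC => h1.
have := le_trans h1 (lerD (NP _ (leq_maxl _ _)) (MP _ (leq_maxr _ _))).
rewrite -mulrDr -{1}[`|l - k|]mulr1 ler_pM2l // -(ler_pM2r (x := 3%:R)) ?ltr0n //.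
by rewrite mulrDl mulVf ?pnatr_eq0 // mul1r -[1 + 1]/(2%:R) ler_nat.
Qed.

Lemma tends_horner (p : {poly K}) y l : tends y l -> tends (fun n => p.[y n]) p.[l].
Proof.
move=> yl; elim/poly_ind: p => [|p c IH].
  rewrite horner0; apply: (@tends_ext _ _ _ 0) (tends_cst 0) => n _.
  by rewrite horner0.
rewrite hornerMXaddC.
apply: (@tends_ext _ _ _ 0) (tendsD (tendsM IH yl) (tends_cst c)) => n _.
by rewrite hornerMXaddC.
Qed.

Lemma tends_inv y l : l != 0 -> tends y l -> tends (fun n => (y n)^-1) l^-1.
Proof.
move=> l0 yl.
have l2 : 0 < `|l| / 2%:R by rewrite divr_gt0 ?normr_gt0 // ltr0n.
have [N NP] := yl _ l2.
have low n : (N <= n)%N -> `|l| / 2%:R <= `|y n|.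
  move=> /NP b; have := ler_normB (y n) (y n - l).
  rewrite opprB addrC subrK => h.
  rewrite -(lerD2r (`|l| / 2%:R)) -splitr; apply: le_trans h _.
  by rewrite lerD2l.
have yn0 n : (N <= n)%N -> y n != 0.
  by move=> /low; rewrite -normr_gt0; apply: lt_le_trans.
apply: (tends_sub0 _ _).2.
apply: (@tends_ext (fun n => if (N <= n)%N then (y n)^-1 - l^-1 else 0) _ _ N).
  by move=> n ->.
apply: (tends0_le (C := (`|l| / 2%:R)^-1 * `|l|^-1) (f := fun n => y n - l)).
  exact: (tends_sub0 _ _).1 yl.
move=> n; case: ifP => [Nn|_]; last first.
  by rewrite normr0 !mulr_ge0 ?invr_ge0 // ltW.
have -> : (y n)^-1 - l^-1 = (y n)^-1 * l^-1 * (l - y n).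
  by field; rewrite l0 yn0.
rewrite !normrM !normfV distrC ler_wpM2r // ler_wpM2r ?invr_ge0 //.
by rewrite lef_pV2 ?posrE ?low // normr_gt0 yn0.
Qed.

Lemma tends_sum m (F : 'I_m -> nat -> K) (l : 'I_m -> K) :
  (forall i, tends (F i) (l i)) -> tends (fun n => \sum_i F i n) (\sum_i l i).
Proof.
elim: m F l => [|m IH] F l H.
  rewrite big_ord0; apply: (@tends_ext (fun=> 0) _ _ 0); last exact: tends_cst.
  by move=> n _; rewrite big_ord0.
rewrite big_ord_recl; have IH' := IH _ _ (fun i => H (lift ord0 i)).
apply: (@tends_ext _ _ _ 0) (tendsD (H ord0) IH') => n _.
by rewrite big_ord_recl.
Qed.

End Tends.

Section ArchimedeanTends.
Variable K : archiNumFieldType.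

Lemma tends_inv_nat : tends (fun n => n.+1%:R^-1 : K) 0.
Proof.
move=> e e0; exists (Num.bound e^-1) => n Nn; rewrite subr0.
rewrite ger0_norm ?invr_ge0 ?ler0n // -[e]invrK lef_pV2 ?posrE ?ltr0n ?invr_gt0 //.
apply: le_trans (ltW (archi_boundP _)) _; first by rewrite invr_ge0 ltW.
by rewrite ler_nat ltnW.
Qed.

(** Bernoulli's inequality for [r^-1 = 1 + d] bounds [r ^+ n] by [(r * d)^-1 / n.+1]. *)
Lemma tends_geom (r : K) : 0 <= r -> r < 1 -> tends (fun n => r ^+ n) 0.
Proof.
move=> r0 r1; have [->|rn0] := eqVneq r 0.
  apply: (@tends_ext _ (fun=> 0) _ _ 1); last exact: tends_cst.
  by case=> // n _; rewrite exprS mul0r.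
have rp : 0 < r by rewrite lt_def rn0.
pose d := r^-1 - 1.
have d0 : 0 < d by rewrite subr_gt0 -invr1 ltf_pV2 // posrE.
apply: (tends0_le (C := (r * d)^-1) tends_inv_nat) => n.
have bern k : 1 + k%:R * d <= r^-1 ^+ k.
  elim: k => [|k IH]; first by rewrite mul0r addr0 expr0.
  have E : r^-1 = 1 + d by rewrite /d addrC subrK.
  rewrite exprS; apply: le_trans (ler_wpM2l _ IH); last by rewrite invr_ge0.
  rewrite E -subr_ge0.
  have -> : (1 + d) * (1 + k%:R * d) - (1 + k.+1%:R * d) = k%:R * d ^+ 2.
    by rewrite -natr1; ring.
  by rewrite mulr_ge0 ?exprn_ge0 // ltW.
rewrite ger0_norm ?exprn_ge0 // ger0_norm ?invr_ge0 ?ler0n //.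
have := bern n.+1; rewrite exprVn => b.
have b' : n.+1%:R * d <= (r ^+ n.+1)^-1 by apply: le_trans b; rewrite lerDr.
rewrite -invfM -[r ^+ n]invrK lef_pV2 ?posrE ?invr_gt0 ?exprn_gt0 ?mulr_gt0 ?ltr0n //.
rewrite -mulrA mulrC -[X in X * r]mulrC -ler_pdivlMr //.
by apply: le_trans b' _; rewrite exprS invfM mulrC.
Qed.

End ArchimedeanTends.

(** * Sequences with one dominant exponential and a polynomial factor *)

Implicit Types (y f g : nat -> algC) (z : algC) (c : seq algC).

Definition shiftop z y n := y n.+1 - z * y n.

(* With S the shift of sequences: the product of the (S - z) over z in zs annihilates y. *)
Fixpoint killed (zs : seq algC) y : Prop :=
  if zs is z :: zs' then killed zs' (shiftop z y) else forall n, y n = 0.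

Lemma killed_ext zs y f : y =1 f -> killed zs y -> killed zs f.
Proof.
elim: zs y f => [|z zs IH] y f yf /=; first by move=> y0 n; rewrite -yf.
by apply: IH => n; rewrite /shiftop !yf.
Qed.

Definition geom_bounded (theta : algC) y := exists C, forall n, `|y n| <= C * theta ^+ n.

(** In [y n.+1 = z * y n + O(theta ^+ n)] a bound with constant [C'] propagates once
    [|z| * C' + C <= theta * C']; the summand [|y 0|] covers the start. *)
Lemma geom_bounded_shift theta z y : `|z| < theta ->
  geom_bounded theta (shiftop z y) -> geom_bounded theta y.
Proof.
move=> ztheta [C yC].
have d0 : 0 < theta - `|z| by rewrite subr_gt0.
have th0 : 0 <= theta by apply: ltW; apply: le_lt_trans ztheta.
have C0 : 0 <= C by have := yC 0%N; rewrite expr0 mulr1; apply: le_trans.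
pose C' := `|y 0%N| + C / (theta - `|z|).
exists C'; elim=> [|n IH]; first by rewrite expr0 mulr1 lerDl divr_ge0 // ltW.
have -> : y n.+1 = z * y n + shiftop z y n by rewrite /shiftop addrC subrK.
apply: le_trans (ler_normD _ _) _; rewrite normrM.
apply: le_trans (lerD (ler_wpM2l (normr_ge0 z) IH) (yC n)) _.
rewrite mulrA -mulrDl exprS mulrA ler_wpM2r ?exprn_ge0 // -lerBrDl.
rewrite (mulrC `|z|) -mulrBr mulrDl mulfVK ?gt_eqF // lerDr.
by rewrite mulr_ge0 // ltW.
Qed.

Lemma geom_bounded_killed theta zs y : (forall z, z \in zs -> `|z| < theta) ->
  killed zs y -> geom_bounded theta y.
Proof.
elim: zs y => [|z zs IH] y zsP /= ky.
  by exists 0 => n; rewrite ky normr0 mul0r.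
apply: (geom_bounded_shift (zsP z (mem_head _ _))).
by apply: IH => // t tzs; apply: zsP; rewrite inE tzs orbT.
Qed.

(* Polynomials in n are written in the basis of the binomials C(n, j), on which the
   difference operator acts by dropping the first coefficient. *)
Definition binsum c (n : nat) : algC := \sum_(j < size c) c`_j * 'C(n, j)%:R.

Lemma binsum_cons x c n : binsum (x :: c) n = x + \sum_(j < size c) c`_j * 'C(n, j.+1)%:R.
Proof. by rewrite /binsum big_ord_recl bin0 mulr1. Qed.

Lemma binsumS c n : binsum c n.+1 = binsum c n + binsum (behead c) n.
Proof.
case: c => [|x c]; first by rewrite /binsum !big_ord0 addr0.
rewrite !binsum_cons /= -addrA; congr (_ + _); rewrite -big_split /=.
by apply: eq_bigr => j _; rewrite binS natrD mulrDr.
Qed.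

Definition expoly (lam theta : algC) y :=
  exists c, geom_bounded theta (fun n => y n - lam ^+ n * binsum c n).

(** On [lam ^+ n * P n] the operator [S - lam] acts as [lam] times the difference operator on [P].
    In the binomial basis, summation shifts the coefficients and prepends the value at 0. *)
Lemma expoly_exact lam k y : lam != 0 -> killed (nseq k lam) y ->
  exists c, forall n, y n = lam ^+ n * binsum c n.
Proof.
move=> lam0; elim: k y => [|k IH] y /=.
  by exists [::] => n; rewrite /binsum big_ord0 mulr0.
case/IH=> c cP; exists (y 0%N :: [seq lam^-1 * x | x <- c]).
elim=> [|n IHn].
  rewrite expr0 mul1r binsum_cons big1 ?addr0 // => j _.
  by rewrite bin0n mulr0.
have -> : y n.+1 = lam * y n + shiftop lam y n by rewrite /shiftop addrC subrK.
rewrite cP {}IHn binsumS /= mulrA -exprS mulrDr; congr (_ + _).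
rewrite /binsum size_map mulr_sumr mulr_sumr.
apply: eq_bigr => j _; rewrite (nth_map 0) // exprS.
by field.
Qed.

(** Since [z != lam], [S - z] acts on the polynomial factor by an invertible triangular system,
    solved by [d]. Subtracting this particular solution from [y] leaves a recurrence covered by
    [geom_bounded_shift]. *)
Lemma expoly_shift lam theta z y : z != lam -> `|z| < theta ->
  expoly lam theta (shiftop z y) -> expoly lam theta y.
Proof.
move=> zlam zth [c cP].
have [d [dc dP]] : exists d : seq algC, size d = size c /\
    forall j, (lam - z) * d`_j + lam * d`_j.+1 = c`_j.
  elim: c {cP} => [|x c [d [dc dP]]].
    by exists [::]; split=> // j; rewrite !nth_nil !mulr0 addr0.
  exists ((x - lam * d`_0) / (lam - z) :: d); split=> [|[|j]] /=.
  - by rewrite dc.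
  - by field; rewrite subr_eq0 eq_sym.
  - exact: dP.
exists d; apply: (geom_bounded_shift zth).
have [C CP] := cP; exists C => n; have := CP n.
suff -> : shiftop z (fun n => y n - lam ^+ n * binsum d n) n =
  shiftop z y n - lam ^+ n * binsum c n by [].
have -> : binsum c n = (lam - z) * binsum d n + lam * binsum (behead d) n.
  have -> : binsum (behead d) n = \sum_(j < size d) d`_j.+1 * 'C(n, j)%:R.
    case: (d) => [|x d']; first by rewrite /binsum !big_ord0.
    by rewrite /= big_ord_recr /= [X in X * _]nth_default // mul0r addr0.
  rewrite /binsum -dc !mulr_sumr -big_split /=; apply: eq_bigr => j _.
  by rewrite -dP mulrDl !mulrA.
rewrite /shiftop binsumS exprS; ring.
Qed.

Lemma expoly_killed lam theta zs k y : lam != 0 ->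
  (forall z, z \in zs -> `|z| < theta /\ z != lam) ->
  killed (zs ++ nseq k lam) y -> expoly lam theta y.
Proof.
move=> lam0; elim: zs y => [|z zs IH] y zsP /=.
  case/(expoly_exact lam0) => c cP; exists c; exists 0 => n.
  by rewrite cP subrr normr0 mul0r.
move=> ky; have [zth zl] := zsP z (mem_head _ _).
apply: (expoly_shift zl zth); apply: IH => // t tzs.
by apply: zsP; rewrite inE tzs orbT.
Qed.

Lemma tends_bin_ratio j k : (j < k)%N ->
  tends (fun n => 'C(n, j)%:R / 'C(n, k)%:R : algC) 0.
Proof.
have step i : tends (fun n => 'C(n, i)%:R / 'C(n, i.+1)%:R : algC) 0.
  move=> e e0.
  have [N NP] := tends0Ml (i.+1%:R : algC) (@tends_inv_nat algC) e0.
  exists (N + i.+1)%N => n Nn.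
  have -> : 'C(n, i)%:R / 'C(n, i.+1)%:R = i.+1%:R * (n - i.+1).+1%:R^-1 :> algC.
    have lin : (i.+1 <= n)%N by apply: leq_trans Nn; rewrite leq_addl.
    apply/eqP; rewrite eqr_div ?pnatr_eq0 //; last by rewrite -lt0n bin_gt0.
    by rewrite -!natrM eqr_nat subnSK // mulnC mul_bin_left mulnC.
  have := NP (n - i.+1)%N; rewrite /=; apply.
  by rewrite leq_subRL 1?addnC //; apply: leq_trans Nn; rewrite leq_addl.
elim: k => // k IH; rewrite ltnS leq_eqVlt => /orP[/eqP->|jk]; first exact: step.
have := tendsM (IH jk) (step k); rewrite mulr0.
apply: (@tends_ext _ _ _ _ k) => n kn.
by rewrite mulrA mulfVK // pnatr_eq0 -lt0n bin_gt0.
Qed.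

(** The index [k] only bounds the degree and its coefficient may vanish, so that two sequences can
    be normalised by the same [lam ^+ n * 'C(n, k)]. *)
Lemma expoly_leading lam theta y c k : 0 < theta -> theta < lam ->
  geom_bounded theta (fun n => y n - lam ^+ n * binsum c n) ->
  (forall j, (k < j)%N -> c`_j = 0) ->
  tends (fun n => y n / (lam ^+ n * 'C(n, k)%:R)) c`_k.
Proof.
move=> th0 thl [C CP] c0.
have l0 : 0 < lam by apply: lt_trans thl.
pose r n := (y n - lam ^+ n * binsum c n) / (lam ^+ n * 'C(n, k)%:R).
have r0 : tends r 0.
  have g0 : tends (fun n => (theta / lam) ^+ n) 0.
    by apply: tends_geom; rewrite ?divr_ge0 ?ltW // ltr_pdivrMr // mul1r.
  apply: (@tends_ext _ (fun n => if (k <= n)%N then r n else 0) _ _ k).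
    by move=> n ->.
  have C0 : 0 <= C by have := CP 0%N; rewrite expr0 mulr1; apply: le_trans.
  apply: (tends0_le (C := C) g0) => n; case: ifP => kn; last first.
    by rewrite normr0 mulr_ge0.
  rewrite /r normrM normfV normrM.
  rewrite [`|(theta / lam) ^+ n|]ger0_norm ?exprn_ge0 ?divr_ge0 ?(ltW th0) ?(ltW l0) //.
  rewrite (ger0_norm (exprn_ge0 n (ltW l0))) (ger0_norm (ler0n _ _)).
  rewrite expr_div_n mulrA; apply: ler_pM => //.
    by rewrite invr_ge0 mulr_ge0 // exprn_ge0 // ltW.
  rewrite lef_pV2 ?posrE ?mulr_gt0 ?exprn_gt0 ?ltr0n ?bin_gt0 //.
  by rewrite ler_peMr ?exprn_ge0 ?(ltW l0) // ler1n bin_gt0.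
have s0 : tends (fun n => binsum c n / 'C(n, k)%:R) c`_k.
  have e1 : c`_k = \sum_(j < size c) if (j : nat) == k then c`_k else 0.
    have [kc|kc] := ltnP k (size c).
      rewrite (bigD1 (Ordinal kc)) //= eqxx big1 ?addr0 // => j /eqP jk.
      by case: eqP => // e; case: jk; apply: val_inj.
    by rewrite nth_default // big1 // => j _; case: ifP.
  rewrite [X in tends _ X]e1.
  apply: (@tends_ext _ (fun n => \sum_(j < size c) c`_j * ('C(n, j)%:R / 'C(n, k)%:R)) _ _ 0).
    by move=> n _; rewrite /binsum mulr_suml; apply: eq_bigr => j _; rewrite mulrA.
  apply: tends_sum => j; case: ltngtP => [jk|kj|->].
  - exact/tends0Ml/tends_bin_ratio.
  - by rewrite c0 //; apply: (@tends_ext _ (fun=> 0) _ _ 0) (tends_cst 0) => n _; rewrite mul0r.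
  - apply: (@tends_ext _ (fun=> c`_k) _ _ k) (tends_cst _) => n kn.
    by rewrite divff ?mulr1 // pnatr_eq0 -lt0n bin_gt0.
have := tendsD r0 s0; rewrite add0r; apply: (@tends_ext _ _ _ _ k) => n kn.
rewrite /r; field; rewrite pnatr_eq0 -lt0n bin_gt0 kn /=.
by rewrite expf_neq0 // gt_eqF.
Qed.

(** Both sequences are normalised at the larger of the two degrees. As [Y n <= C * X n], the
    coefficient of [X] there cannot vanish unless that of [Y] does. The last hypothesis provides a
    nonzero coefficient. *)
Lemma expoly_ratio lam theta (X Y : nat -> algC) C : 0 < theta -> theta < lam ->
  (forall n, 0 < X n) -> (forall n, X n <= Y n) -> (forall n, Y n <= C * X n) ->
  expoly lam theta X -> expoly lam theta Y -> ~ geom_bounded theta Y ->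
  exists L, tends (fun n => Y n / X n) L.
Proof.
move=> th0 thl X0 XY YX [c cX] [d dY] nY.
pose P k := (c`_k != 0) || (d`_k != 0).
have Pm k : P k -> (k <= maxn (size c) (size d))%N.
  rewrite leqNgt; apply: contraTN; rewrite gtn_max => /andP[kc kd].
  by rewrite /P !nth_default ?eqxx // ltnW.
have exP : exists k, P k.
  have [/existsP[k kP]|] := boolP [exists k : 'I_(maxn (size c) (size d)).+1, P k].
    by exists k.
  rewrite negb_exists => /forallP nP; case: nY.
  have [D DP] := dY; exists D => n; have := DP n.
  rewrite /binsum big1 ?mulr0 ?subr0 // => j _.
  have jm : (j < (maxn (size c) (size d)).+1)%N.
    by rewrite ltnS leq_max (ltnW (ltn_ord j)) orbT.
  by have := nP (Ordinal jm); rewrite negb_or !negbK => /andP[_ /eqP->]; rewrite mul0r.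
have [k kP kmax] := ex_maxnP exP Pm.
have above j : (k < j)%N -> c`_j = 0 /\ d`_j = 0.
  move=> kj; have : ~~ P j by apply: contraTN kj => /kmax; rewrite -leqNgt.
  by rewrite negb_or !negbK => /andP[/eqP-> /eqP->].
have l0 : 0 < lam by apply: lt_trans thl.
have Xl := expoly_leading th0 thl cX (fun j kj => (above j kj).1).
have Yl := expoly_leading th0 thl dY (fun j kj => (above j kj).2).
have c0 : c`_k != 0.
  apply/eqP => ck0; move: kP; rewrite /P ck0 eqxx /= => /eqP; apply.
  rewrite ck0 in Xl.
  have Y0 : tends (fun n => Y n / (lam ^+ n * 'C(n, k)%:R)) 0.
    apply: (tends0_le (C := C) Xl) => n.
    rewrite !normrM mulrA ler_wpM2r //.
    by rewrite !gtr0_norm ?(lt_le_trans (X0 n) (XY n)).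
  exact: tends_unique Yl Y0.
have := tendsM Yl (tends_inv c0 Xl); move=> H; exists (d`_k / c`_k).
apply: (tends_ext (N := k)) H => n kn; field.
rewrite (gt_eqF (X0 n)) pnatr_eq0 -lt0n bin_gt0 kn /=.
by rewrite expf_neq0 // gt_eqF.
Qed.

End ExponentialPolynomials.

(** * Dominant eigenvalue of a morphism *)

Module MorphismLengths.
Import all_boot all_order all_algebra all_field.
Import ring.
Import ExponentialPolynomials.
Set Implicit Arguments. Unset Strict Implicit. Unset Printing Implicit Defensive.
Import Order.TTheory GRing.Theory Num.Theory.
Local Open Scope ring_scope.

Definition msub (T : Type) (G : T -> seq T) (s : seq T) := flatten [seq G c | c <- s].

Lemma msub_cat (T : Type) (G : T -> seq T) s t : msub G (s ++ t) = msub G s ++ msub G t.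
Proof. by rewrite /msub map_cat flatten_cat. Qed.

Lemma iter_msub_cat (T : Type) (G : T -> seq T) n s t :
  iter n (msub G) (s ++ t) = iter n (msub G) s ++ iter n (msub G) t.
Proof. by elim: n => // n IH; rewrite !iterS IH msub_cat. Qed.

Lemma iter_msub_nil (T : Type) (G : T -> seq T) n : iter n (msub G) [::] = [::].
Proof. by elim: n => // n IH; rewrite iterS IH. Qed.

Lemma geom_gap (a C s theta : algC) : 0 <= a -> 0 <= theta -> theta < s ->
  (forall n, a * s ^+ n <= C * theta ^+ n) -> a = 0.
Proof.
move=> a0 th0 ths H.
have s0 : 0 < s by apply: le_lt_trans ths.
have g0 : tends (fun n => (theta / s) ^+ n) 0.
  by apply: tends_geom; rewrite ?divr_ge0 ?(ltW s0) // ltr_pdivrMr // mul1r.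
suff : tends (fun=> a) 0 by apply: tends_unique; exact: tends_cst.
apply: (tends0_le (C := C) g0) => n.
rewrite !ger0_norm ?exprn_ge0 ?divr_ge0 ?(ltW s0) //.
by rewrite expr_div_n mulrA ler_pdivlMr ?exprn_gt0.
Qed.

Lemma max_norm (s : seq algC) : s != [::] ->
  exists2 z, z \in s & forall t, t \in s -> `|t| <= `|z|.
Proof.
elim: s => // x s IH _; have [->|s0] := eqVneq s [::].
  by exists x; [exact: mem_head | move=> t; rewrite inE => /eqP->].
have [z zs zP] := IH s0.
have [xz|zx] := real_leP (normr_real x) (normr_real z).
  exists z; first by rewrite inE zs orbT.
  by move=> t; rewrite inE => /predU1P[->|/zP].
exists x; first exact: mem_head.
move=> t; rewrite inE => /predU1P[->//|/zP tz].
exact: le_trans tz (ltW zx).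
Qed.

Lemma norm_gap (s : seq algC) lam : 0 < lam -> (forall z, z \in s -> `|z| < lam) ->
  exists theta, [/\ 0 < theta, theta < lam & forall z, z \in s -> `|z| < theta].
Proof.
move=> l0 sl.
have [z zs zP] := @max_norm (0 :: s) isT.
have zl : `|z| < lam.
  by move: zs; rewrite inE => /predU1P[->|/sl//]; rewrite normr0.
have [h1 h2] := midf_lt zl.
exists ((`|z| + lam) / 2%:R); split=> //.
  by apply: le_lt_trans h1.
move=> t ts; apply: le_lt_trans h1; apply: zP; by rewrite inE ts orbT.
Qed.

(** Equality case of the triangle inequality for [y = (y - 1) + 1]: both summands then point in the
    direction of 1. *)
Lemma norm_sub1_eq (y : algC) : `|y - 1| + 1 <= `|y| -> 0 <= y.
Proof.
move=> h.
have e : `|(y - 1) + 1| = `|y - 1| + `|1|.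
  apply/le_anti; rewrite ler_normD /= normr1 subrK h //.
have [t [_ [e1 e2]]] := normCDeq e.
move: e2 e1; rewrite normr1 mul1r => <-; rewrite mulr1 => e1.
by rewrite -[y](subrK 1) e1 addr_ge0.
Qed.

(** Applying [S - z] to [v M^n k] replaces [v] by [v (M - z)]. Together with Cayley-Hamilton, the
    eigenvalues of [M] therefore kill all such sequences. *)
Lemma killed_mx N (M : 'M[algC]_N.+1) (v : 'rV_N.+1) (k : 'cV_N.+1) zs :
  v *m horner_mx M (\prod_(z <- zs) ('X - z%:P)) = 0 ->
  killed zs (fun n => (v *m M ^+ n *m k) 0 0).
Proof.
elim: zs v => [|z zs IH] v /=.
  by rewrite big_nil rmorph1 mulmx1 => -> n; rewrite !mul0mx mxE.
rewrite big_cons rmorphM /= => h.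
have {}IH := IH (v *m (M - z%:M)).
apply: killed_ext (IH _) => [n|].
  rewrite /shiftop exprS -!mulmxA mulmxBl mulmxBr mul_scalar_mx -scalemxAr.
  by rewrite !mulmxA -!mulmxA !mxE; congr (_ - _); rewrite mxE.
move: h; rewrite rmorphB /= horner_mx_X horner_mx_C.
by rewrite -mulmxA.
Qed.

Section MorphismLengths.
Variables (T : finType) (G : T -> seq T).

Definition wlen n c := size (iter n (msub G) [:: c]).

Lemma size_iter_msub n s : size (iter n (msub G) s) = (\sum_(c <- s) wlen n c)%N.
Proof.
elim: s => [|c s IH]; first by rewrite iter_msub_nil big_nil.
by rewrite -cat1s iter_msub_cat size_cat IH big_cons.
Qed.

Lemma sum_count (F : T -> nat) s : (\sum_(c <- s) F c = \sum_c count_mem c s * F c)%N.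
Proof.
elim: s => [|d s IH]; first by rewrite big_nil big1.
rewrite big_cons IH (bigD1 d) //= [RHS](bigD1 d) //= eqxx mulnDl mul1n -addnA.
congr (_ + (_ + _))%N; apply: eq_bigr => c cd.
by rewrite eq_sym (negPf cd) add0n.
Qed.

Lemma wlenS n c : wlen n.+1 c = (\sum_d count_mem d (G c) * wlen n d)%N.
Proof. by rewrite /wlen iterSr /= /msub /= cats0 -sum_count -size_iter_msub. Qed.

Lemma wlen_reach n k (s : seq T) c : c \in iter k (msub G) s ->
  (wlen n c <= size (iter (n + k) (msub G) s))%N.
Proof.
move=> cs; rewrite iterD size_iter_msub (big_rem c) //=; exact: leq_addr.
Qed.

(** A Perron-Frobenius argument for the incidence matrix [A]. By the first hypothesis every positive
    entry of [A] is positive in [A ^+ 2], so the spectral radius [lam] is the only eigenvalue of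
    largest modulus. By the second, the letters supporting its eigenvector occur in the iterated
    words, so [Y] is not of smaller exponential order. *)
Lemma tends_length_ratio_reachable (W W' : seq T) (C : nat) :
  (forall c d, d \in G c -> exists2 e, e \in G c & d \in G e) ->
  (forall c, G c != [::] -> exists k, c \in iter k (msub G) (W ++ W')) ->
  let X n := size (iter n (msub G) W) in
  let Y n := size (iter n (msub G) W') in
  (forall n, 0 < X n)%N -> (forall n, X n <= Y n)%N -> (forall n, Y n <= C * X n)%N ->
  exists L : algC, tends (fun n => (Y n)%:R / (X n)%:R) L.
Proof.
move=> idem reach X Y X0 XY YX.
(* Matrices are taken in dimension [N.+1]; [T] is inhabited because [W] is nonempty. *)
have [N NT] : exists N, #|T| = N.+1.
  exists #|T|.-1; rewrite prednK //; have := X0 0%N; rewrite /X /=; case: (W) => // c _ _.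
  by apply/card_gt0P; exists c.
pose ev (i : 'I_N.+1) : T := enum_val (cast_ord (esym NT) i).
pose rk (c : T) : 'I_N.+1 := cast_ord NT (enum_rank c).
have evK : cancel ev rk by move=> i; rewrite /ev /rk enum_valK cast_ordKV.
have rkK : cancel rk ev by move=> c; rewrite /ev /rk cast_ordK enum_rankK.
have ev_bij : bijective ev by exists rk.
pose A : 'M[algC]_N.+1 := \matrix_(i, j) (count_mem (ev i) (G (ev j)))%:R.
have A_ge0 i j : 0 <= A i j by rewrite mxE ler0n.
pose x n : 'rV[algC]_N.+1 := \row_j (wlen n (ev j))%:R.
have xS n : x n.+1 = x n *m A.
  apply/rowP => j; rewrite !mxE wlenS (reindex ev) /=; last exact: onW_bij.
  by rewrite natr_sum; apply: eq_bigr => i _; rewrite !mxE mulrC natrM.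
have xE n : x n = x 0%N *m A ^+ n.
  by elim: n => [|n IH]; rewrite ?expr0 ?mulmx1 // exprSr mulmxA -IH xS.
pose kap (s : seq T) : 'cV[algC]_N.+1 := \col_j (count_mem (ev j) s)%:R.
have sizeE s n : (size (iter n (msub G) s))%:R = (x 0%N *m A ^+ n *m kap s) 0 0.
  rewrite -xE size_iter_msub sum_count mxE (reindex ev) /=; last exact: onW_bij.
  by rewrite natr_sum; apply: eq_bigr => i _; rewrite !mxE mulrC natrM.
have [zs zsE] : exists zs, char_poly A = \prod_(z <- zs) ('X - z%:P).
  have [zs zsE] := closed_field_poly_normal (char_poly A); exists zs.
  by rewrite {1}zsE (monicP (char_poly_monic A)) scale1r.
have zs0 : zs != [::].
  apply/eqP => e; have := size_char_poly A; by rewrite zsE e big_nil size_poly1.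
have killedA rs s : perm_eq rs zs -> killed rs (fun n => (size (iter n (msub G) s))%:R).
  move=> rz; apply: (@killed_ext _ (fun n => (x 0%N *m A ^+ n *m kap s) 0 0)).
    by move=> n; rewrite sizeE.
  by apply: killed_mx; rewrite (perm_big _ rz) /= -zsE Cayley_Hamilton mulmx0.
have [z0 z0s z0max] := max_norm zs0.
pose lam := `|z0|.
have growth theta s : lam < theta ->
    geom_bounded theta (fun n => (size (iter n (msub G) s))%:R).
  move=> lt; apply: (@geom_bounded_killed _ zs); last exact: killedA.
  by move=> z /z0max zl; apply: le_lt_trans lt.
have eigv z : z \in zs -> exists2 v : 'rV_N.+1, v *m A = z *: v & v != 0.
  move=> zin; apply/eigenvalueP; rewrite eigenvalue_root_char zsE.
  by rewrite root_prod_XsubC.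
pose abs (v : 'rV[algC]_N.+1) : 'rV_N.+1 := \row_i `|v 0 i|.
have Apow_ge0 n i j : 0 <= (A ^+ n) i j.
  elim: n i j => [|n IH] i j; first by rewrite expr0 mxE ler0n.
  by rewrite exprS mxE; apply: sumr_ge0 => l _; apply: mulr_ge0.
(* The row [x 0] is all ones, so [wlen n (ev j)] is the [j]-th column sum of [A ^+ n]; up to a
   constant it dominates the orbit of [abs v]. *)
have dom v : exists2 B, 0 <= B & forall n j, (abs v *m A ^+ n) 0 j <= B * (wlen n (ev j))%:R.
  exists (\sum_i `|v 0 i|) => [|n j]; first by apply: sumr_ge0.
  have -> : (wlen n (ev j))%:R = \sum_i (A ^+ n) i j.
    have <- : x n 0 j = (wlen n (ev j))%:R by rewrite mxE.
    by rewrite xE mxE; apply: eq_bigr => i _; rewrite mxE mul1r.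
  rewrite mxE mulr_suml; apply: ler_sum => i _; rewrite mxE ler_wpM2l //.
  rewrite (bigD1 i) //= lerDl; apply: sumr_ge0 => l _; exact: Apow_ge0.
have abs_mul (v : 'rV_N.+1) (M : 'M_N.+1) j : (forall i, 0 <= M i j) ->
    `|(v *m M) 0 j| <= (abs v *m M) 0 j.
  move=> M0; rewrite !mxE; apply: le_trans (ler_norm_sum _ _ _) _.
  by apply: ler_sum => i _; rewrite mxE normrM (ger0_norm (M0 i)).
have eig_pow (v : 'rV[algC]_N.+1) z n : v *m A = z *: v -> v *m A ^+ n = z ^+ n *: v.
  move=> vz; elim: n => [|n IH]; first by rewrite !expr0 mulmx1 scale1r.
  by rewrite exprSr mulmxA IH -scalemxAl vz scalerA -exprSr.
have nz_coord (v : 'rV[algC]_N.+1) : v != 0 -> exists j, v 0 j != 0.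
  move=> v0; apply/existsP; apply: contraR v0; rewrite negb_exists => /forallP h.
  by apply/eqP/rowP => j; rewrite mxE; have := h j; rewrite negbK => /eqP.
have lam_gt0 : 0 < lam.
  rewrite lt_def normr_ge0 andbT; apply/eqP => lam0.
  have h12 : 0 < 2%:R^-1 :> algC by rewrite invr_gt0 ltr0n.
  have [|B BP] := @growth 2%:R^-1 W; first by rewrite lam0.
  have : (1 : algC) = 0.
    apply: (@geom_gap _ B 1 2%:R^-1) => //; first exact: ltW.
      by rewrite -[X in _ < X]invr1 ltf_pV2 ?posrE ?ltr0n // ltr1n.
    move=> n; rewrite expr1n mulr1; apply: le_trans (BP n).
    by rewrite ger0_norm ?ler0n // ler1n; exact: X0.
  by move/eqP; rewrite oner_eq0.
have eig_lower v z : z \in zs -> v *m A = z *: v -> forall n j,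
    `|z| ^+ n * `|v 0 j| <= (abs v *m A ^+ n) 0 j.
  move=> zin vz n j; rewrite -normrX -normrM.
  have -> : z ^+ n * v 0 j = (v *m A ^+ n) 0 j by rewrite (eig_pow _ _ _ vz) mxE.
  by apply: abs_mul => i; exact: Apow_ge0.
(* K A^2 - A >= 0 entrywise and |z| = lam give |v| A^2 >= (lam (|K z - 1| + 1) / K) |v|. As
   |v| A^n grows no faster than theta^n for any theta > lam, |K z - 1| + 1 <= |K z|, which
   forces z >= 0. *)
have dominant z : z \in zs -> `|z| = lam -> z = lam.
  move=> zin zl.
  have [v vz v0] := eigv z zin.
  (* [K] exceeds every entry of [A], and wherever [A] is positive [A ^+ 2] is at least 1. *)
  pose K := (\sum_c \sum_d count_mem c (G d)).+1.
  have KA i j : 0 <= (K%:R *: A ^+ 2 - A) i j.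
    rewrite !mxE subr_ge0.
    have [Gij|] := boolP (ev i \in G (ev j)); last first.
      move/count_memPn => ->; apply: mulr_ge0; first exact: ler0n.
      by apply: sumr_ge0 => l _; apply: mulr_ge0.
    have [e ej ie] := idem _ _ Gij.
    apply: (@le_trans _ _ (K%:R * 1)).
      rewrite mulr1 ler_nat; apply: leq_trans (leqnSn _).
      by rewrite (bigD1 (ev i)) //= (bigD1 (ev j)) //= -addnA leq_addr.
    apply: ler_wpM2l; first exact: ler0n.
    rewrite (bigD1 (rk e)) //=; apply: (@le_trans _ _ (A i (rk e) * A (rk e) j)).
      by rewrite !mxE rkK -natrM ler1n muln_gt0 -!has_count !has_pred1 ie ej.
    rewrite lerDl; apply: sumr_ge0 => l _; exact: mulr_ge0.
  pose c0 := lam * (`|K%:R * z - 1| + 1) / K%:R.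
  have K0 : 0 < K%:R :> algC by rewrite ltr0n.
  have c00 : 0 <= c0 by rewrite divr_ge0 ?ler0n // mulr_ge0 ?addr_ge0 // ltW.
  have step j : c0 * `|v 0 j| <= (abs v *m A ^+ 2) 0 j.
    rewrite /c0 mulrAC ler_pdivrMr // [X in _ <= X]mulrC.
    have -> : K%:R * (abs v *m A ^+ 2) 0 j =
        (abs v *m (K%:R *: A ^+ 2 - A)) 0 j + (abs v *m A) 0 j.
      have e : K%:R *: A ^+ 2 = (K%:R *: A ^+ 2 - A) + A by rewrite subrK.
      transitivity ((abs v *m (K%:R *: A ^+ 2)) 0 j); first by rewrite -scalemxAr [RHS]mxE.
      by rewrite {1}e mulmxDr [LHS]mxE.
    have b1 := abs_mul v _ j (fun i => KA i j).
    have b2 := abs_mul v A j (fun i => A_ge0 i j).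
    apply: le_trans (lerD b1 b2).
    rewrite mulmxBr -scalemxAr (eig_pow _ _ 2 vz) vz !mxE -zl.
    rewrite [X in _ <= `|X| + _](_ : _ = z * (K%:R * z - 1) * v 0 j); last by ring.
    by rewrite !normrM le_eqVlt; apply/orP; left; apply/eqP; ring.
  have stepn n j : c0 ^+ n * `|v 0 j| <= (abs v *m (A ^+ 2) ^+ n) 0 j.
    elim: n j => [|n IH] j; first by rewrite !expr0 mul1r mulmx1 mxE.
    rewrite exprS [A ^+ 2 ^+ n.+1]exprSr mulmxA.
    have -> : c0 * c0 ^+ n * `|v 0 j| = c0 ^+ n * (c0 * `|v 0 j|) by ring.
    apply: le_trans (ler_wpM2l (exprn_ge0 n c00) (step j)) _.
    rewrite !mxE mulr_sumr; apply: ler_sum => i _.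
    rewrite mulrA mxE; apply: ler_wpM2r; [exact: Apow_ge0 | exact: IH].
  have [j vj] := nz_coord v v0.
  (* Otherwise some [theta] strictly between [lam] and the square root of [c0] bounds the orbit of
     [abs v] under [A ^+ 2] by [O(theta^(2n))], against the growth [c0 ^+ n] of [stepn]. *)
  have c0lam : c0 <= lam ^+ 2.
    rewrite real_leNgt ?ger0_real ?exprn_ge0 ?normr_ge0 //; apply/negP => gap.
    pose s := sqrtC c0.
    have s0 : 0 <= s by rewrite sqrtC_ge0.
    have ls : lam < s by rewrite -(ltr_pXn2r (n := 2)) ?nnegrE ?normr_ge0 // sqrtCK.
    have [lt ts] := midf_lt ls.
    set theta := (lam + s) / 2%:R in lt ts.
    have th0 : 0 <= theta by apply: ltW; apply: lt_trans lt.
    have [D DP] := growth theta [:: ev j] lt.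
    have [B B0 BP] := dom v.
    have D0 : 0 <= D by have := DP 0%N; rewrite expr0 mulr1; apply: le_trans.
    suff : `|v 0 j| = 0 by move/eqP; rewrite normr_eq0 (negPf vj).
    apply: (@geom_gap _ (B * D) c0 (theta ^+ 2)) => //; first exact: exprn_ge0.
      by rewrite -(sqrtCK c0) ltr_pXn2r ?nnegrE.
    move=> n; rewrite mulrC; apply: le_trans (stepn n j) _.
    rewrite -!exprM; apply: le_trans (BP _ _) _; rewrite -mulrA ler_wpM2l //.
    by apply: le_trans (DP _); rewrite ger0_norm ?ler0n.
  have : `|K%:R * z - 1| + 1 <= `|K%:R * z|.
    rewrite normrM (ger0_norm (ler0n _ _)) zl.
    have := c0lam; rewrite /c0 ler_pdivrMr // expr2 -mulrA ler_pM2l //.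
    by rewrite (mulrC lam).
  move/norm_sub1_eq; rewrite pmulr_rge0 // => z_ge0.
  by rewrite -zl ger0_norm.
pose zs1 := [seq z <- zs | z != lam].
have [||theta [th0 thl zs1P]] := @norm_gap zs1 lam => //.
  move=> z; rewrite mem_filter => /andP[znl zin].
  rewrite lt_def z0max // andbT; apply: contra znl => /eqP e.
  by apply/eqP/dominant.
(* The copies of [lam] go last, the order that [expoly_killed] expects. *)
have zs_perm : perm_eq (zs1 ++ nseq (count_mem lam zs) lam) zs.
  rewrite perm_sym -(perm_filterC (fun z => z != lam) zs) perm_cat2l.
  rewrite (_ : nseq _ _ = [seq x <- zs | predC (fun z => z != lam) x]) //.
  rewrite -size_filter; apply/esym.
  rewrite (eq_filter (a2 := pred1 lam)); last by move=> z /=; rewrite negbK.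
  by apply/all_pred1P/filter_all.
have ep s : expoly lam theta (fun n => (size (iter n (msub G) s))%:R).
  apply: (@expoly_killed _ _ zs1 (count_mem lam zs)); first by rewrite gt_eqF.
    by move=> z zin; split; [exact: zs1P | move: zin; rewrite mem_filter => /andP[]].
  exact: killedA.
apply: (@expoly_ratio lam theta _ _ C%:R) => //.
- by move=> n; rewrite ltr0n; exact: X0.
- by move=> n; rewrite ler_nat; exact: XY.
- by move=> n; rewrite -natrM ler_nat; exact: YX.
- exact: ep.
- exact: ep.
case=> D DP.
have [v vz v0] := eigv z0 z0s.
have [j vj] := nz_coord v v0.
(* If [G (ev j)] were empty, column [j] of [A] would vanish, and so would [z0 * v 0 j]. Hence [ev j]
   is reachable, and [lam ^+ n * |v 0 j|] is at most a constant times [Y (n + k)]; the factor 2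
   below comes from [X <= Y]. *)
have [k kP] : exists k, ev j \in iter k (msub G) (W ++ W').
  apply: reach; apply: contra vj => /eqP Gj.
  have z00 : z0 != 0 by rewrite -normr_gt0.
  have := congr1 (fun u : 'rV_N.+1 => u 0 j) vz; rewrite !mxE big1.
    by move/esym/eqP; rewrite mulf_eq0 (negPf z00).
  by move=> i _; rewrite mxE Gj mulr0.
have [B B0 BP] := dom v.
suff : `|v 0 j| = 0 by move/eqP; rewrite normr_eq0 (negPf vj).
apply: (@geom_gap _ (B * (2%:R * (D * theta ^+ k))) lam theta) => //; first exact: ltW.
move=> n; rewrite mulrC; apply: le_trans (eig_lower _ _ z0s vz n j) _.
apply: le_trans (BP _ _) _; rewrite -mulrA ler_wpM2l //.
apply: (@le_trans _ _ (2%:R * (Y (n + k)%N)%:R)).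
  rewrite -natrM ler_nat; apply: leq_trans (wlen_reach n kP) _.
  by rewrite iter_msub_cat size_cat mul2n -addnn leq_add2r; exact: XY.
rewrite -mulrA ler_wpM2l ?ler0n // -mulrA -exprD addnC.
by apply: le_trans (DP _); rewrite ger0_norm ?ler0n // addnC.
Qed.
End MorphismLengths.

End MorphismLengths.

(** * Ratios of lengths of iterated morphic images *)

Module LengthRatios.
Import all_boot all_order all_algebra all_field.
Import ring Rstruct.
Import ExponentialPolynomials MorphismLengths.
Set Implicit Arguments. Unset Strict Implicit. Unset Printing Implicit Defensive.
Import Order.TTheory GRing.Theory Num.Theory.
Local Open Scope ring_scope.
Local Notation R := Rdefinitions.R.

(** The preperiod and the period of every orbit are at most [#|T|], so the factorial of [#|T|]
    exceeds the former and is a multiple of the latter. *)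
Lemma iter_idempotent (T : finType) (f : T -> T) :
  exists2 p, (0 < p)%N & forall x n, (0 < n)%N -> iter (p * n) f x = iter p f x.
Proof.
exists #|T|`!; first exact: fact_gt0.
move=> x n n0; set p := #|T|`!.
have /trajectP[i io e] := looping_order f x.
have oT : (fingraph.order f x <= #|T|)%N by apply: max_card.
have ip : (i <= p)%N.
  by apply: ltnW; apply: leq_trans io (leq_trans oT _); rewrite /p fact_geq.
have e1 k : iter (i + (fingraph.order f x - i) * k) f x = iter i f x.
  elim: k => [|k IH]; first by rewrite muln0 addn0.
  by rewrite mulnS addnA subnKC ?(ltnW io) // addnC iterD e -iterD addnC.
have e2 m k : (i <= m)%N -> iter (m + (fingraph.order f x - i) * k) f x = iter m f x.
  move=> im; rewrite -{1}(subnK im) -addnA iterD e1 -iterD subnK //.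
have : (fingraph.order f x - i %| p)%N.
  by apply: dvdn_fact; rewrite subn_gt0 io /= (leq_trans (leq_subr _ _)).
case/dvdnP=> d pd; case: n n0 => // n _.
by rewrite mulnS {2}pd -mulnA mulnCA e2.
Qed.

Section PowerOfMorphism.
Variables (T : finType) (G : T -> seq T).

Definition mpow p c := iter p (msub G) [:: c].

Lemma iter_msub_flatten n s :
  iter n (msub G) s = flatten [seq iter n (msub G) [:: c] | c <- s].
Proof.
elim: s => [|c s IH]; first by rewrite iter_msub_nil.
by rewrite -cat1s iter_msub_cat IH.
Qed.

Lemma iter_mpow p n s : iter n (msub (mpow p)) s = iter (p * n) (msub G) s.
Proof.
elim: n => [|n IH]; first by rewrite muln0.
by rewrite mulnS iterD iterS IH [RHS]iter_msub_flatten.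
Qed.

Lemma mem_msub d s : d \in msub G s = [exists c, (c \in s) && (d \in G c)].
Proof.
apply/flatten_mapP/existsP => [[c cs dc]|[c /andP[cs dc]]]; first by exists c; rewrite cs.
by exists c.
Qed.

End PowerOfMorphism.

(** The set of letters of [G^n(s)] evolves under a self-map of the finite power set of [T], to which
    [iter_idempotent] applies. *)
Lemma mpow_idempotent (T : finType) (G : T -> seq T) :
  exists2 p, (0 < p)%N & forall c d,
    (d \in msub (mpow G p) (mpow G p c)) = (d \in mpow G p c).
Proof.
pose f (S : {set T}) := [set d | [exists c, (c \in S) && (d \in G c)]].
have fE n s : [set d in iter n (msub G) s] = iter n f [set d in s].
  elim: n => // n IH; rewrite !iterS -IH; apply/setP => d; rewrite !inE mem_msub.
  by apply: eq_existsb => c; rewrite inE.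
have [p p0 pP] := iter_idempotent f; exists p => // c d.
have := pP [set d in [:: c]] 2 isT; rewrite -!fE => /setP/(_ d).
rewrite !inE => <-.
by rewrite -iter_mpow /= [in RHS]/mpow /= /msub /= cats0.
Qed.

(** Along the residue class of [r], the words start at [G^r(W)] and [G^r(W')] and evolve under the
    power [mpow G p], whose letter sets are stable. *)
Lemma tends_length_ratio (T : finType) (G : T -> seq T) (W W' : seq T) (C : nat) :
  let X n := size (iter n (msub G) W) in
  let Y n := size (iter n (msub G) W') in
  (forall n, 0 < X n)%N -> (forall n, X n <= Y n)%N -> (forall n, Y n <= C * X n)%N ->
  exists2 p, (0 < p)%N & forall r,
    exists L : algC, tends (fun n => (Y (p * n + r)%N)%:R / (X (p * n + r)%N)%:R) L.
Proof.
move=> X Y X0 XY YX; have [p p0 pP] := mpow_idempotent G.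
exists p => // r; set G2 := mpow G p in pP.
pose V := iter r (msub G) W ++ iter r (msub G) W'.
pose rch c := has (fun b => connect (fun c d => d \in G2 c) b c) V.
(* Unreachable letters are erased, so that the dominant eigenvalue governs the growth of Y. *)
pose G3 c := if rch c then G2 c else [::].
have Rstep c d : rch c -> d \in G2 c -> rch d.
  move=> /hasP[b bV bc] cd; apply/hasP; exists b => //.
  exact: connect_trans bc (connect1 cd).
have RV c : c \in V -> rch c by move=> cV; apply/hasP; exists c.
have G3E n s : {subset s <= V} -> iter n (msub G3) s = iter n (msub G2) s /\
    {in iter n (msub G2) s, forall c, rch c}.
  move=> sV; elim: n => [|n [IH1 IH2]]; first by split=> // c /sV/RV.
  rewrite !iterS IH1; split.
    by congr flatten; apply/eq_in_map => c cs; rewrite /G3 IH2.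
  by move=> d /flatten_mapP[c cs]; apply: Rstep; exact: IH2.
have sV1 : {subset iter r (msub G) W <= V} by move=> c; rewrite mem_cat => ->.
have sV2 : {subset iter r (msub G) W' <= V} by move=> c; rewrite mem_cat => ->; rewrite orbT.
have lenE n s : {subset iter r (msub G) s <= V} ->
    iter n (msub G3) (iter r (msub G) s) = iter (p * n + r) (msub G) s.
  by move=> sV; rewrite (G3E n _ sV).1 iter_mpow iterD.
have [|||||L LP] := @tends_length_ratio_reachable _ G3 (iter r (msub G) W)
    (iter r (msub G) W') C.
- move=> c d; rewrite /G3; case: ifP => // Rc.
  rewrite -pP => /flatten_mapP[e ec de]; exists e => //.
  by rewrite (Rstep _ _ Rc ec).
- move=> c; rewrite {1}/G3; case: ifP => // /hasP[b bV /connectP[q]].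
  have [n bn] : exists n, b \in iter n (msub G3) V by exists 0%N.
  have Rb := RV _ bV; move: (b) n bn Rb => b' n bn Rb' pq -> _.
  elim: q b' n bn Rb' pq => [|d q IH] b' n bn Rb' /=; first by exists n.
  case/andP=> bd; apply: (IH d n.+1); last exact: Rstep bd.
  by rewrite iterS; apply/flatten_mapP; exists b' => //; rewrite /G3 Rb'.
- by move=> n; rewrite lenE //; exact: X0.
- by move=> n; rewrite !lenE //; exact: XY.
- by move=> n; rewrite !lenE //; exact: YX.
by exists L; apply: (@tends_ext _ _ _ _ 0) LP => n _; rewrite !lenE.
Qed.

(** * Transfer of limits from algebraic numbers to the reals *)

Lemma Un_cvP (u : nat -> R) (l : R) : Rseries.Un_cv u l <-> tends u l.
Proof.
split=> H e e0.
  have [|N NP] := H e; first exact/RltP.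
  exists N => n /ssrnat.leP Nn; have := NP n Nn; rewrite RdistE => /RltP; exact: ltW.
have [|N NP] := H (e / 2%:R); first by rewrite divr_gt0 ?ltr0n //; exact/RltP.
exists N => n /ssrnat.leP /NP h; rewrite RdistE; apply/RltP; apply: le_lt_trans h _.
by rewrite ltr_pdivrMr ?ltr0n // ltr_pMr ?ltr1n //; exact/RltP.
Qed.

Definition Z_of_int (x : int) : BinNums.Z :=
  match x with Posz n => BinInt.Z.of_nat n | Negz n => BinInt.Z.opp (BinInt.Z.of_nat n.+1) end.

Lemma IZR_of_int x : Rdefinitions.IZR (Z_of_int x) = x%:~R.
Proof.
case: x => n; rewrite /Z_of_int; first by rewrite -RIneq.INR_IZR_INZ INRE.
by rewrite RIneq.opp_IZR -RIneq.INR_IZR_INZ INRE NegzE mulrNz.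
Qed.

Lemma zpoly_evalE (q : {poly int}) (x : R) :
  Defs.zpoly_eval [seq Z_of_int c | c <- q] x = (map_poly intr q).[x].
Proof.
have -> : (map_poly intr q).[x] = horner_rec [seq (c%:~R : R) | c <- q] x.
  rewrite /horner map_polyE (@PolyK _ 1) //.
  by case: q => s /= s0; rewrite (last_map (fun c : int => c%:~R : R) s 1) intr_eq0.
elim: (q : seq int) => //= c s IH.
by rewrite -IH IZR_of_int [RHS]addrC [in RHS]mulrC.
Qed.

(** Clearing denominators turns [p] into an integer polynomial; its leading coefficient is the
    required nonzero entry. *)
Lemma root_is_algebraic (p : {poly rat}) (x : R) : p != 0 ->
  (map_poly ratr p).[x] = 0 -> Defs.is_algebraic x.
Proof.
move=> p0 px; have [q [a a0 pq]] := rat_poly_scale p.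
have q0 : q != 0 by apply: contra p0 => /eqP q0; rewrite pq q0 rmorph0 scaler0.
exists [seq Z_of_int c | c <- q]; split; last first.
  rewrite zpoly_evalE; move: px; rewrite pq map_polyZ hornerZ -map_poly_comp /=.
  rewrite (eq_map_poly (g := intr)); last by move=> c /=; rewrite ratr_int.
  move/eqP; rewrite mulf_eq0 fmorph_eq0 invr_eq0 intr_eq0 (negPf a0) /=.
  by move/eqP.
have : lead_coef q != 0 by rewrite lead_coef_eq0.
have : lead_coef q \in (q : seq int) by rewrite lead_coefE mem_nth // prednK // size_poly_gt0.
elim: (q : seq int) => //= c s IH; rewrite inE => /predU1P[<- l0|ls l0].
  by apply: List.Exists_cons_hd; case: (lead_coef q) l0 => [[|n]|n].
exact/List.Exists_cons_tl/IH.
Qed.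

(* The convergence p(r n) -> 0, with p the minimal polynomial of l, only involves rational
   numbers and can therefore be transferred from algC to R. *)
Lemma algebraic_limit (r : nat -> rat) (l : algC) :
  tends (fun n => ratr (r n)) l ->
  exists2 L : R, tends (fun n => ratr (r n) : R) L & Defs.is_algebraic L.
Proof.
move=> rl.
have small (e : R) : 0 < e -> exists2 q : rat, 0 < q & ratr q <= e.
  move=> e0; exists (Num.bound e^-1).+1%:R^-1; first by rewrite invr_gt0 ltr0n.
  rewrite fmorphV /= ratr_nat -[X in _ <= X]invrK lef_pV2 ?posrE ?invr_gt0 ?ltr0n //.
  apply: le_trans (ltW (archi_boundP _)) _; first by rewrite invr_ge0 ltW.
  by rewrite ler_nat leqnSn.
have cauchy : Rseries.Cauchy_crit (fun n => ratr (r n) : R).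
  move=> e /RltP e0.
  have [|q q0 qe] := small (e / 3%:R); first by rewrite divr_gt0 ?ltr0n.
  have [|N NP] := rl (ratr q); first by rewrite ltr0q.
  exists N => n m /ssrnat.leP Nn /ssrnat.leP Nm; rewrite RdistE; apply/RltP.
  have b : `|r n - r m| <= q + q.
    rewrite -(ler_rat algC) ratr_norm rmorphB rmorphD /=.
    apply: le_trans (ler_distD l _ _) _; rewrite [`|l - _|]distrC.
    exact: lerD (NP _ Nn) (NP _ Nm).
  move: b; rewrite -(ler_rat R) ratr_norm rmorphB rmorphD /= => b.
  apply: le_lt_trans b _; apply: le_lt_trans (lerD qe qe) _.
  rewrite -mulrDl ltr_pdivrMr ?ltr0n // -{1 2}[e]mulr1 -mulrDr ltr_pM2l //.
  by rewrite -[1 + 1]/(2%:R) ltr_nat.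
have [L /Un_cvP LP] := Rcomplete.R_complete _ cauchy.
exists L => //.
have [p [pE pm _]] := minCpolyP l.
apply: (root_is_algebraic (monic_neq0 pm)).
have hornE (K : numFieldType) x : (map_poly ratr p).[ratr x] = ratr p.[x] :> K.
  by rewrite horner_map.
have p0 : tends (fun n => (map_poly ratr p).[ratr (r n)] : algC) 0.
  have : (map_poly ratr p).[l] = 0 by rewrite -pE; apply/eqP/root_minCpoly.
  by move=> h; have := tends_horner (map_poly ratr p) rl; rewrite h.
apply: (tends_unique (tends_horner (map_poly ratr p) LP)).
move=> e /small[q q0 qe]; have [|N NP] := p0 (ratr q); first by rewrite ltr0q.
exists N => n /NP; rewrite !subr0 !hornE -!ratr_norm ler_rat => h.
by apply: le_trans qe; rewrite ler_rat.
Qed.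

Theorem length_ratio_limit (T : finType) (G : T -> seq T) (W W' : seq T) (C : nat) :
  let X n := size (iter n (msub G) W) in
  let Y n := size (iter n (msub G) W') in
  (forall n, 0 < X n)%N -> (forall n, X n <= Y n)%N -> (forall n, Y n <= C * X n)%N ->
  exists2 p, (0 < p)%N & forall r, exists2 L : R, Defs.is_algebraic L &
    tends (fun n => (Y (p * n + r)%N)%:R / (X (p * n + r)%N)%:R : R) L.
Proof.
move=> X Y X0 XY YX; have [p p0 pP] := tends_length_ratio X0 XY YX.
exists p => // r; have [l lP] := pP r.
have [|L LP La] := @algebraic_limit (fun n => (Y (p * n + r)%N)%:R / (X (p * n + r)%N)%:R) l.
  by apply: (@tends_ext _ _ _ _ 0) lP => n _; rewrite fmorph_div /= !ratr_nat.
exists L => //; apply: (@tends_ext _ _ _ _ 0) LP => n _.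
by rewrite fmorph_div /= !ratr_nat.
Qed.

End LengthRatios.

(** * Gaps between alive letters of a fixed point *)

Module AliveGaps.
Import all_boot zify boolp.
Import MorphismLengths.
Set Implicit Arguments. Unset Strict Implicit. Unset Printing Implicit Defensive.
Section LastIndex.
Variables (T : Type) (x0 : T) (Q : pred T).

(** Index of the last element satisfying [Q]; truncated subtraction makes it 0 if there is none. *)
Definition rfind (l : seq T) := (size l - (find Q (rev l)).+1)%N.

Lemma rfindP l : has Q l -> [/\ rfind l < size l, Q (nth x0 l (rfind l)) &
  forall i, rfind l < i < size l -> ~~ Q (nth x0 l i)].
Proof.
rewrite /rfind -has_rev => h; have f := h; rewrite has_find size_rev in f.
split; first by rewrite ltn_subrL /= (leq_ltn_trans _ f).
  by rewrite -nth_rev // nth_find.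
move=> i /andP[i1 i2]; rewrite -[l]revK nth_rev ?size_rev //.
by rewrite before_find //; lia.
Qed.

End LastIndex.

(** * Blocks of a fixed point and images of gaps *)

Section FixedPointWord.
Variables (T : finType) (g : T -> seq T) (u : nat -> T).

(** Position at which the block [g (u k)] starts in [u], once [u] is fixed by [g]. *)
Definition image_pos k := size (msub g (mkseq u k)).

Hypothesis fixu : forall k, msub g (mkseq u k) = mkseq u (image_pos k).
Hypothesis posgt : forall k, 0 < k -> k < image_pos k.

Lemma image_posS k : image_pos k.+1 = image_pos k + size (g (u k)).
Proof. by rewrite /image_pos /mkseq -addn1 iotaD map_cat msub_cat size_cat /msub /= cats0. Qed.

Lemma image_pos_le k l : k <= l -> image_pos k <= image_pos l.
Proof. by move=> kl; apply: (homo_leq (fun x => leqnn x) leq_trans _ kl) => i; rewrite image_posS leq_addr. Qed.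

Lemma nth_image k i : i < size (g (u k)) -> u (image_pos k + i) = nth (u 0) (g (u k)) i.
Proof.
move=> ik; have e : mkseq u (image_pos k.+1) = mkseq u (image_pos k) ++ g (u k).
  by rewrite -!fixu /mkseq -[k.+1]addn1 iotaD map_cat msub_cat [in X in _ ++ X]/msub /= cats0.
have := congr1 (fun s => nth (u 0) s (image_pos k + i)) e.
rewrite nth_mkseq; last by rewrite image_posS ltn_add2l.
by rewrite nth_cat size_mkseq ltnNge leq_addr /= addKn.
Qed.

(** The letter at [x] lies in the block of its parent [r]. The bound [r < x] allows descent on
    positions. *)
Lemma parent x : exists r i, [/\ x = image_pos r + i, i < size (g (u r)) & (0 < x -> r < x)].
Proof.
have ex : exists k, x < image_pos k.+1 by exists x; apply: ltn_trans (posgt _).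
have [r xr rmin] := ex_minnP ex.
have rx : image_pos r <= x.
  by case: r rmin {xr} => // r rmin; rewrite leqNgt; apply/negP => /rmin; rewrite ltnn.
exists r, (x - image_pos r); split.
- by rewrite subnKC.
- by rewrite -(ltn_add2l (image_pos r)) subnKC // -image_posS.
- by case: (r) rx => // r' rx _; apply: leq_trans rx; apply: posgt.
Qed.

Definition consecutive (Q : pred T) s t :=
  [/\ s < t, Q (u s), Q (u t) & forall y, s < y < t -> ~~ Q (u y)].

(** Together with [first_image], the ends of the image of a gap: the last [Q]-letter in the block of
    the left end and the first one in the block of the right end. *)
Definition last_image (Q : pred T) s := image_pos s + rfind Q (g (u s)).
Definition first_image (Q : pred T) t := image_pos t + find Q (g (u t)).

Section Images.
(** Two predicates, since [Q] is later both [alive] itself and the predicate of nonzero digits. *)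
Variables (alive Q : pred T).
Hypothesis aliveE : forall c, alive c = has Q (g c).

Lemma last_imageP s : alive (u s) ->
  [/\ image_pos s <= last_image Q s < image_pos s.+1, Q (u (last_image Q s)) &
      forall y, last_image Q s < y < image_pos s.+1 -> ~~ Q (u y)].
Proof.
rewrite aliveE /last_image => /(rfindP (u 0))[h1 h2 h3]; split.
- by rewrite leq_addr image_posS ltn_add2l.
- by rewrite nth_image.
- move=> y; rewrite image_posS => /andP[y1 y2].
  have -> : y = image_pos s + (y - image_pos s) by lia.
  by rewrite nth_image ?h3 //; lia.
Qed.

Lemma first_imageP t : alive (u t) ->
  [/\ image_pos t <= first_image Q t < image_pos t.+1, Q (u (first_image Q t)) &
      forall y, image_pos t <= y < first_image Q t -> ~~ Q (u y)].
Proof.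
rewrite aliveE /first_image => h; have f := h; rewrite has_find in f; split.
- by rewrite leq_addr image_posS ltn_add2l.
- by rewrite nth_image // nth_find.
- move=> y /andP[y1 y2].
  have -> : y = image_pos t + (y - image_pos t) by lia.
  by rewrite nth_image ?before_find //; lia.
Qed.

Lemma alive_parent x : Q (u x) ->
  exists r, [/\ alive (u r), image_pos r <= x < image_pos r.+1 & (0 < x -> r < x)].
Proof.
move=> Qx; have [r [i [xE ir rx]]] := parent x; exists r; split=> //.
  rewrite aliveE; apply/hasP; exists (nth (u 0) (g (u r)) i); first exact: mem_nth.
  by rewrite -nth_image // -xE.
by rewrite xE leq_addr image_posS ltn_add2l.
Qed.

(** A [Q]-letter strictly inside the image would have an alive parent strictly between [s] and
    [t]. *)
Lemma consecutive_image s t : consecutive alive s t ->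
  consecutive Q (last_image Q s) (first_image Q t).
Proof.
case=> st /last_imageP[s1 s2 s3] /first_imageP[t1 t2 t3] mid.
have st' := image_pos_le st; split=> //; first by lia.
move=> y yst; case: (ltnP y (image_pos s.+1)) => [ys|ys]; first by apply: s3; lia.
case: (leqP (image_pos t) y) => [ty|ty]; first by apply: t3; lia.
apply/negP => /alive_parent[r [ar yr _]].
have sr : s < r by rewrite ltnNge; apply/negP => rs; have := @image_pos_le r.+1 s.+1 rs; lia.
have rt : r < t by rewrite ltnNge; apply/negP => tr; have := image_pos_le tr; lia.
by move: ar; apply/negP; apply: mid; rewrite sr.
Qed.

(** The parents of the two ends decide: if they coincide, the gap is born inside one block;
    otherwise they are themselves consecutive alive positions. *)
Lemma consecutive_preimage s' t' : consecutive Q s' t' ->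
  (exists2 r, alive (u r) & image_pos r <= s' /\ t' < image_pos r.+1) \/
  (exists s t, [/\ consecutive alive s t, s' = last_image Q s & t' = first_image Q t]).
Proof.
case=> st Qs Qt mid.
have [s [as_ ss _]] := alive_parent Qs; have [t [at_ tt _]] := alive_parent Qt.
have := ltngtP s t; case=> [lt_st|ts|e].
- right; exists s, t; have [s1 s2 s3] := last_imageP as_; have [t1 t2 t3] := first_imageP at_.
  have st' := image_pos_le lt_st.
  split.
  + split=> // y /andP[sy yt]; apply/negP => ay; have [y1 y2 _] := last_imageP ay.
    have := image_pos_le sy; have := image_pos_le yt => p1 p2.
    by move: y2; apply/negP/mid; lia.
  + have := ltngtP s' (last_image Q s); case=> // h.
      by have := mid (last_image Q s); rewrite s2 => /(_ _)/negP; case=> //; lia.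
    by have := s3 s'; rewrite Qs => /(_ _)/negP; case=> //; lia.
  + have := ltngtP t' (first_image Q t); case=> // h.
      by have := t3 t'; rewrite Qt => /(_ _)/negP; case=> //; lia.
    by have := mid (first_image Q t); rewrite t2 => /(_ _)/negP; case=> //; lia.
- by have := image_pos_le ts; lia.
- by left; exists s => //; rewrite {2}e; lia.
Qed.

End Images.

(** * Orbits of gaps and their copies further left *)

Variable alive : pred T.
Hypothesis alive_stable : forall c, alive c = has alive (g c).

(** Only [s = 0] needs an argument: the least positive alive position has a smaller alive parent,
    which must be 0, so the block of 0 contains an alive position beyond 0. *)
Lemma last_image_gt s t : consecutive alive s t -> s < last_image alive s.
Proof.
case=> st as_ at_ _; have [/andP[h _] _ _] := last_imageP alive_stable as_.
case: s st as_ h => [|s] st as_ h; last by apply: leq_trans (posgt _) h.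
have ex : exists x, alive (u x) && (0 < x) by exists t; rewrite at_.
have [x /andP[ax x0] xmin] := ex_minnP ex.
have [r [ar xr rx]] := alive_parent alive_stable ax.
move/(_ x0): rx; case: r ar xr => [_ xr _|r ar _ rx']; last first.
  by have := xmin r.+1; rewrite ar /= => /(_ isT); lia.
have [_ _ h3] := last_imageP alive_stable as_.
rewrite lt0n; apply/eqP => l0.
by have := h3 x; rewrite ax l0 x0 => /(_ _)/negP; case=> //; lia.
Qed.

(** The factor of length [D + 1] at [s] also occurs at [s'], no further right. *)
Definition similar s s' D := s' <= s /\ forall i, i <= D -> u (s + i) = u (s' + i).

Lemma similar_pos s s' D i : similar s s' D -> i <= D.+1 ->
  image_pos (s + i) + image_pos s' = image_pos (s' + i) + image_pos s.
Proof.
move=> [_ sim]; elim: i => [|i IH] iD; first by rewrite !addn0 addnC.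
by rewrite !addnS !image_posS sim //; have := IH (ltnW iD); lia.
Qed.

Lemma similar_image_letters s s' D x : similar s s' D ->
  image_pos s <= x < image_pos (s + D.+1) -> u x = u (image_pos s' + (x - image_pos s)).
Proof.
move=> sim /andP[x1 x2].
have [r [i [xE ir _]]] := parent x.
have sr : s <= r by rewrite leqNgt; apply/negP => rs; have := image_pos_le rs; rewrite image_posS; lia.
have rD : r < s + D.+1 by rewrite ltnNge; apply/negP => h; have := image_pos_le h; lia.
have e := @similar_pos _ _ _ (r - s) sim.
have eu : u r = u (s' + (r - s)).
  by rewrite -{1}(subnKC sr); apply: sim.2; lia.
rewrite xE nth_image // eu -nth_image -?eu //; congr u.
by have := e _; rewrite subnKC //; lia.
Qed.

(** Equal factors have equal images, so a copy of a gap keeps the same length as the original under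
    every iterate. *)
Lemma similar_image s t s' : consecutive alive s t -> similar s s' (t - s) ->
  [/\ consecutive alive s' (s' + (t - s)),
   first_image alive t - last_image alive s =
   first_image alive (s' + (t - s)) - last_image alive s' &
   similar (last_image alive s) (last_image alive s')
     (first_image alive t - last_image alive s)].
Proof.
move=> cst sim; have [st as_ at_ mid] := cst.
have es : u s = u s' by have := sim.2 0; rewrite !addn0; apply.
have et : u t = u (s' + (t - s)) by rewrite -sim.2 // subnKC // ltnW.
have cst' : consecutive alive s' (s' + (t - s)).
  split; [lia | by rewrite -es | by rewrite -et |].
  move=> y ys; rewrite (_ : y = s' + (y - s')); last by lia.
  by rewrite -sim.2 ?mid //; lia.
have ep := @similar_pos _ _ _ (t - s) sim (leqnSn _).
have [l1 _ _] := last_imageP alive_stable as_.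
have [f1 _ _] := first_imageP alive_stable at_.
have [lt_im _ _ _] := consecutive_image alive_stable cst.
rewrite subnKC in ep; last exact: ltnW.
have e1 : last_image alive s + image_pos s' = last_image alive s' + image_pos s.
  by rewrite /last_image es; lia.
have e2 : first_image alive t + image_pos s' = first_image alive (s' + (t - s)) + image_pos s.
  by rewrite /first_image -et; lia.
have ps := image_pos_le sim.1.
split=> //; first by lia.
split; first by lia.
move=> i iD; rewrite (similar_image_letters sim).
  by congr u; lia.
by rewrite -subSn ?(ltnW st) // subnKC; [lia | exact: leqW (ltnW st)].
Qed.

Lemma finite_occurrences : exists B, forall x, exists r, [/\ r <= B, r <= x & u r = u x].
Proof.
suff [B BP] : exists B, forall x, u x \in enum T -> exists r, [/\ r <= B, r <= x & u r = u x].
  by exists B => x; apply: BP; rewrite mem_enum.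
elim: (enum T) => [|c l [B BP]]; first by exists 0.
have [[x0 xc]|nx] := pselect (exists x, u x = c); last first.
  exists B => x; rewrite inE => /predU1P[xc|/BP //].
  by case: nx; exists x.
exists (maxn B x0) => x; rewrite inE => /predU1P[xc'|/BP[r [r1 r2 r3]]].
  case: (leqP x0 x) => [h|h].
    by exists x0; rewrite leq_maxr h xc xc'.
  by exists x; rewrite leqnn leq_max (ltnW h) orbT.
by exists r; rewrite leq_max r1.
Qed.

Notation phi := (last_image alive).
Notation psi := (first_image alive).

Lemma consecutive_iter s t n : consecutive alive s t ->
  consecutive alive (iter n phi s) (iter n psi t).
Proof. by move=> c; elim: n => //= n IH; apply: consecutive_image. Qed.

Lemma iter_last_image_ge s t n : consecutive alive s t -> n <= iter n phi s.
Proof.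
move=> c; elim: n => //= n IH.
exact: leq_ltn_trans IH (last_image_gt (consecutive_iter n c)).
Qed.

Lemma consecutive_roots : exists B, forall s t, consecutive alive s t ->
  exists s0 t0 n, [/\ t0 <= B, consecutive alive s0 t0, iter n phi s0 <= s &
    t - s = iter n psi t0 - iter n phi s0].
Proof.
have [B BP] := finite_occurrences.
exists (image_pos B.+1).
suff H m : forall s t, t < m -> consecutive alive s t ->
  exists s0 t0 n, [/\ t0 <= image_pos B.+1, consecutive alive s0 t0,
    similar s (iter n phi s0) (t - s) & t - s = iter n psi t0 - iter n phi s0].
  move=> s t c; have [s0 [t0 [n [h1 h2 [h3 _] h4]]]] := H t.+1 s t (ltnSn _) c.
  by exists s0, t0, n.
elim: m => // m IH s t tm c.
have [[r ar [rs tr]]|[s1 [t1 [c1 sE tE]]]] := consecutive_preimage alive_stable c.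
  have [r' [r'B r'r eu]] := BP r.
  have [st _ _ _] := c; move: tr; rewrite image_posS => tr.
  have simr : similar r r' 0 by split=> // i; rewrite leqn0 => /eqP->; rewrite !addn0 eu.
  have sim : similar s (image_pos r' + (s - image_pos r)) (t - s).
    split; first by have := image_pos_le r'r; lia.
    move=> i it; rewrite (similar_image_letters simr); first by congr u; lia.
    by rewrite addn1 image_posS; lia.
  exists (image_pos r' + (s - image_pos r)), (image_pos r' + (s - image_pos r) + (t - s)), 0; split=> //=; last by lia.
    by have := @image_pos_le r'.+1 B.+1 r'B; rewrite [image_pos r'.+1]image_posS eu; lia.
  by have [] := similar_image c sim.
have [t10 _ at1 _] := c1.
have t1m : t1 < m.
  apply: leq_trans (_ : t1 < t) _; last by lia.
  rewrite tE; apply: leq_trans (posgt _) _; first exact: leq_ltn_trans t10.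
  by have [/andP[] ] := first_imageP alive_stable at1.
have [s0 [t0 [n [h1 h2 h3 h4]]]] := IH s1 t1 t1m c1.
have [k1 k2 k3] := similar_image c1 h3.
have e : iter n phi s0 + (t1 - s1) = iter n psi t0.
  by have [lt _ _ _] := consecutive_iter n h2; lia.
exists s0, t0, n.+1; rewrite /= -sE -tE in k2 k3 *; split=> //.
by rewrite -e.
Qed.

Variable K : nat.
Hypothesis sizeK : forall c, size (g c) <= K.

(** The alive position [phi s] exceeds [s], so [t <= phi s], which lies in the block of [s]. This
    linear bound keeps the ratios bounded. *)
Lemma consecutive_le s t : consecutive alive s t -> t <= K * (s + 1).
Proof.
have pK k : image_pos k <= K * k.
  by elim: k => // k IH; rewrite image_posS mulnS addnC leq_add.
move=> c; have [st as_ at_ mid] := c; have gt := last_image_gt c.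
have [/andP[_ h] ap _] := last_imageP alive_stable as_.
rewrite addn1; apply: leq_trans (pK _); apply: leq_trans (ltnW h).
rewrite leqNgt; apply/negP => lt; move: ap; apply/negP/mid; by rewrite gt.
Qed.

Variable nz : pred T.
Hypothesis nzE : forall c, alive c = has nz (g c).

(** The last [nz] and the last alive position of a block, and likewise the first ones, differ by at
    most [K]. *)
Lemma nonzero_gap p q : consecutive nz p q ->
  q <= p + K \/ exists s t, [/\ consecutive alive s t, s <= p + K & q <= t + K].
Proof.
case/(consecutive_preimage nzE) => [[r _ [rp qr]]|[s [t [c pE qE]]]].
  by left; move: qr; rewrite image_posS; have := sizeK (u r); lia.
right; exists (phi s), (psi t); split; first exact: consecutive_image.
  have [_ as_ _ _] := c; have [s1 _ _] := last_imageP nzE as_.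
  have [s2 _ _] := last_imageP alive_stable as_.
  by move: s1 s2; rewrite -pE image_posS; have := sizeK (u s); lia.
have [_ _ at_ _] := c; have [t1 _ _] := first_imageP nzE at_.
have [t2 _ _] := first_imageP alive_stable at_.
by move: t1 t2; rewrite -qE image_posS; have := sizeK (u t); lia.
Qed.

Lemma nonzero_gap_of_alive s t : consecutive alive s t ->
  exists p q, [/\ consecutive nz p q, p <= phi s + K, phi s <= p + K & psi t <= q + K].
Proof.
move=> c; exists (last_image nz s), (first_image nz t); split.
- exact: consecutive_image c.
- have [_ as_ _ _] := c; have [s1 _ _] := last_imageP nzE as_.
  have [s2 _ _] := last_imageP alive_stable as_.
  by move: s1 s2; rewrite image_posS; have := sizeK (u s); lia.
- have [_ as_ _ _] := c; have [s1 _ _] := last_imageP nzE as_.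
  have [s2 _ _] := last_imageP alive_stable as_.
  by move: s1 s2; rewrite image_posS; have := sizeK (u s); lia.
have [_ _ at_ _] := c; have [t1 _ _] := first_imageP nzE at_.
have [t2 _ _] := first_imageP alive_stable at_.
by move: t1 t2; rewrite image_posS; have := sizeK (u t); lia.
Qed.

End FixedPointWord.

End AliveGaps.

(** * From gaps to maximal zero blocks *)

Module BlockLimsup.
Import all_boot zify boolp.
Import MorphismLengths AliveGaps.
Import Defs Reals Lra.
Set Implicit Arguments. Unset Strict Implicit. Unset Printing Implicit Defensive.
Local Open Scope nat_scope.

Section FiniteMax.
Variables (A : eqType) (Kp : R -> Prop).

Lemma finite_max (P : A -> R -> Prop) (L0 : R) (s : seq A) : Kp L0 ->
  (forall x, x \in s -> exists2 L, Kp L & P x L) ->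
  exists L, [/\ Kp L, Rle L0 L, L = L0 \/ (exists2 x, x \in s & P x L) &
    forall x, x \in s -> exists2 l, P x l & Rle l L].
Proof.
move=> K0; elim: s => [|y s IH] H.
  by exists L0; split=> //; [exact: Rle_refl | left].
have [|L [L1 L2 L3 L4]] := IH.
  by move=> x xs; apply: H; rewrite inE xs orbT.
have [M M1 M2] := H y (mem_head _ _).
case: (Rle_dec M L) => ML.
  exists L; split=> //.
    by case: L3 => [->|[x xs xP]]; [left | right; exists x; rewrite ?inE ?xs ?orbT].
  by move=> x; rewrite inE => /predU1P[->|/L4//]; exists M.
exists M; split=> //; first by lra.
  by right; exists y => //; exact: mem_head.
move=> x; rewrite inE => /predU1P[->|/L4[l l1 l2]]; first by exists M => //; exact: Rle_refl.
by exists l => //; lra.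
Qed.

Lemma finite_eventually (Q : A -> nat -> Prop) (s : seq A) :
  (forall x, x \in s -> exists N, forall n, N <= n -> Q x n) ->
  exists N, forall x n, x \in s -> N <= n -> Q x n.
Proof.
elim: s => [|y s IH] H; first by exists 0.
have [|N NP] := IH; first by move=> x xs; apply: H; rewrite inE xs orbT.
have [M MP] := H y (mem_head _ _).
exists (maxn N M) => x n; rewrite inE geq_max => /predU1P[->|xs] /andP[nN nM]; first exact: MP.
exact: NP.
Qed.

End FiniteMax.

(** The limsup is the largest of the limits along the residue classes modulo [p]. *)
Lemma is_limsup_residues (Kp : R -> Prop) (s : nat -> R) p : 0 < p ->
  (forall r, exists2 L, Kp L & Un_cv (fun n => s (p * n + r)) L) ->
  exists2 L, Kp L & is_limsup s L.
Proof.
move=> p0 H; have [L0 L01 L02] := H 0.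
have [|L [KL LL0 Lin Lmax]] := @finite_max _ Kp (fun r L => Un_cv (fun n => s (p * n + r)) L)
  L0 (iota 0 p) L01; first by move=> r _; exact: H.
exists L => //; split=> eps eps0.
  have [|N NP] := @finite_eventually _ (fun r n => Rlt (s (p * n + r)) (L + eps)) (iota 0 p).
    move=> r /Lmax[l cv lL]; have [N NP] := cv eps eps0.
    exists N => n Nn; have := NP n; rewrite /Rdist => /(_ ltac:(lia)) h.
    by have := Rabs_def2 _ _ h; lra.
  exists (p * N) => k kN; rewrite (divn_eq k p) mulnC; apply: NP.
    by rewrite mem_iota ltn_mod.
  by rewrite leq_divRL // mulnC; apply/leP.
have [r cv] : exists r, Un_cv (fun n => s (p * n + r)) L.
  by case: Lin => [->|[r _ cv]]; [exists 0 | exists r].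
move=> N; have [M MP] := cv eps eps0.
exists (p * maxn N M + r); split.
  apply/leP; apply: leq_trans (leq_addr _ _); apply: leq_trans (leq_maxl N M) _.
  by rewrite leq_pmull.
have := MP (maxn N M); rewrite /Rdist => /(_ ltac:(lia)) h.
by have := Rabs_def2 _ _ h; lra.
Qed.

Section ZeroBlocks.
Variables (T : finType) (g : T -> seq T) (u : nat -> T).
Hypothesis fixu : forall k, msub g (mkseq u k) = mkseq u (image_pos g u k).
Hypothesis posgt : forall k, 0 < k -> k < image_pos g u k.
Variables (alive nz : pred T).
Hypothesis alive_stable : forall c, alive c = has alive (g c).
Hypothesis nzE : forall c, alive c = has nz (g c).
Variable w : nat -> nat.
Hypothesis wE : forall k, nz (u k) = (w k != 0).

Lemma block_consecutive i j : 0 < i -> max_zero_block w i j -> consecutive u nz i.-1 j.+1.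
Proof.
move=> i0 [/leP ij [zb [wj wi]]]; split; first by lia.
- by rewrite wE; case: wi => [|/eqP//]; lia.
- by rewrite wE; apply/eqP.
- by move=> y yij; rewrite wE zb //; lia.
Qed.

Lemma consecutive_block p q : consecutive u nz p q -> p.+1 < q -> max_zero_block w p.+1 q.-1.
Proof.
case=> pq np nq mid lt; split; first by lia.
split; [|split].
- move=> t ht; have := mid t; rewrite wE negbK => /(_ ltac:(lia)); exact: eqP.
- by rewrite prednK; [move: nq; rewrite wE => /eqP | lia].
- by right; move: np; rewrite wE => /eqP.
Qed.

Notation phi := (last_image g u alive).
Notation psi := (first_image g u alive).

(* The two added units avoid a division by zero and do not affect the limsup. *)
Definition gap_ratio s t n := ((INR (iter n psi t) + 1) / (INR (iter n phi s) + 1))%R.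

(** [L] is the maximum of 1 and the limsups of the finitely many roots. From above, a block either
    exceeds its start by a bounded amount, or is close to a gap as long as a root image lying no
    further right. From below, the value 1 follows from [i <= j], and a larger one from the images
    of a maximising root. *)
Lemma limsup_zero_blocks (Kp : R -> Prop) : Kp 1%R ->
  (forall s t, consecutive u alive s t -> exists2 L, Kp L &
     is_limsup (gap_ratio s t) L) ->
  infinitely_many_max_zero_blocks w ->
  forall I J, enumerates_max_zero_blocks w I J ->
  exists L, is_limsup (fun k => INR (J k) / INR (I k))%R L /\ Kp L.
Proof.
move=> K1 rootlim infw I J [blk [Iinc enumIJ]].
have [K sizeK] : exists K, forall c, size (g c) <= K.
  exists (\max_c size (g c)) => c; exact: leq_bigmax.
have [B BP] := consecutive_roots fixu posgt alive_stable.
pose roots := [seq x <- [seq (s, t) | s <- iota 0 B.+1, t <- iota 0 B.+1] |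
  `[< consecutive u alive x.1 x.2 >]].
have rootsP s t : t <= B -> consecutive u alive s t -> (s, t) \in roots.
  move=> tB c; have [st _ _ _] := c; rewrite mem_filter; apply/andP; split; first exact/asboolP.
  by apply: allpairs_f; rewrite mem_iota; lia.
pose rho (x : nat * nat) := gap_ratio x.1 x.2.
have [|L [KL L1 Lin Lmax]] := @finite_max _ Kp (fun x L => is_limsup (rho x) L) 1%R roots K1.
  by move=> x; rewrite mem_filter => /andP[/asboolP c _]; exact: rootlim.
exists L; split=> //.
have Ige k : k <= I k by elim: k => // k IH; have := Iinc k; lia.
have Imono k l : k <= l -> I k <= I l.
  by move=> kl; apply: (homo_leq (fun x => leqnn x) leq_trans _ kl) => i; have := Iinc i; lia.
have leI a b : a <= b -> (INR a <= INR b)%R by move=> /leP; exact: le_INR.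
have large (x : R) : exists N, forall n, N <= n -> (x < INR n)%R.
  have [N NP] := INR_unbounded x; exists N => n Nn; have := leI _ _ Nn; lra.
have frac_lt a b c : (0 < INR b)%R -> (INR a < c * INR b)%R -> (INR a / INR b < c)%R.
  by move=> b0 h; apply: (Rmult_lt_reg_r (INR b)) => //; rewrite /Rdiv Rmult_assoc Rinv_l; lra.
split=> eps eps0.
  have [|N0 N0P] := @finite_eventually _ (fun x n => (rho x n < L + eps / 2)%R) roots.
    move=> x /Lmax[l [up _] lL]; have [|N NP] := up (eps / 2)%R; first by lra.
    by exists N => n /leP /NP; lra.
  (* Roots iterated fewer than [N0] times only yield gaps of length at most [D0]. *)
  have [D0 D0P] : exists D0, forall x n, x \in roots -> n < N0 -> iter n psi x.2 <= D0.
    exists (\max_(x <- roots) \max_(n < N0) iter n psi x.2) => x n xr nN.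
    rewrite (big_rem x xr) /= leq_max; apply/orP; left.
    exact: (leq_bigmax (F := fun n : 'I_N0 => iter n psi x.2) (Ordinal nN)).
  have bound i j : 0 < i -> max_zero_block w i j ->
      (INR j <= (L + eps / 2) * INR i + (INR (K + K + D0) + (L + eps / 2) * (INR K + 1)))%R.
    move=> i0 /(block_consecutive i0) c.
    have i0' := pos_INR i; have K0' := pos_INR K.
    have small : j <= i + (K + K + D0) ->
        (INR j <= (L + eps / 2) * INR i + (INR (K + K + D0) + (L + eps / 2) * (INR K + 1)))%R.
      by move=> /leI; rewrite plus_INR => h; nra.
    case: (nonzero_gap fixu posgt alive_stable sizeK nzE c) => [h|[s [t [cst si tj]]]].
      by apply: small; lia.
    have [s0 [t0 [n [t0B c0 s0s te]]]] := BP s t cst.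
    have xr := rootsP _ _ t0B c0.
    have [lt _ _ _] := consecutive_iter fixu posgt alive_stable n c0.
    have [st _ _ _] := cst.
    case: (ltnP n N0) => nN.
      by apply: small; have := D0P _ _ xr nN; rewrite /=; lia.
    have := N0P _ _ xr nN; rewrite /rho /gap_ratio /= => r1.
    have s0' := pos_INR (iter n phi s0).
    have r2 : (INR (iter n psi t0) + 1 < (L + eps / 2) * (INR (iter n phi s0) + 1))%R.
      have := Rmult_lt_compat_r (INR (iter n phi s0) + 1) _ _ _ r1.
      by rewrite /Rdiv Rmult_assoc Rinv_l; lra.
    (* With [c = L + eps / 2 >= 1], the gap length is below [(c - 1)(phi^n s0 + 1)], hence below
       [(c - 1)(s + 1)], so that [t + 1 < c (s + 1)]. *)
    have e : (INR t = INR s + INR (iter n psi t0) - INR (iter n phi s0))%R.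
      have e' : t + iter n phi s0 = s + iter n psi t0 by lia.
      by have := congr1 INR e'; rewrite !plus_INR; lra.
    have h1 := leI _ _ s0s.
    have h2 : (INR s <= INR i + INR K)%R by rewrite -plus_INR; apply: leI; lia.
    have h3 : (INR j <= INR t + INR K)%R by rewrite -plus_INR; apply: leI; lia.
    have h4 := pos_INR D0; rewrite !plus_INR; nra.
  have [N NP] := large ((INR (K + K + D0) + (L + eps / 2) * (INR K + 1)) / (eps / 2))%R.
  exists N.+1 => k kN; have ki : N < I k by apply: leq_trans (Ige k); apply/leP.
  have i0 : 0 < I k by lia.
  have h1 := bound _ _ i0 (blk k).
  have h2 := NP _ (ltnW ki).
  have i0' : (0 < INR (I k))%R by apply: lt_0_INR; lia.
  apply: frac_lt => //.
  have h3 := Rmult_lt_compat_r (eps / 2) _ _ _ h2.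
  move: h3; rewrite /Rdiv Rmult_assoc Rinv_l; lra.
move=> M.
suff [i [j [iM b lt]]] : exists i j, [/\ I M <= i, max_zero_block w i j &
    (INR j / INR i > L - eps)%R].
  have [k [kI kJ]] := enumIJ i j b; exists k; split; last by rewrite kI kJ.
  apply/leP; rewrite leqNgt; apply/negP => kM; have := Iinc k; have := Imono _ _ kM; lia.
have frac_gt a b c : (0 < INR b)%R -> (INR a > c * INR b)%R -> (INR a / INR b > c)%R.
  move=> b0 h; apply: (Rmult_lt_reg_r (INR b)) => //; rewrite /Rdiv Rmult_assoc Rinv_l; lra.
case: (Req_dec L 1) => [->|Ln1].
  have [i [j [/leP iM b]]] := infw (I M).+1; exists i, j; split=> //; first exact: ltnW.
  have [/leP ij _] := b; have := leI _ _ ij => h.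
  have i0 : (0 < INR i)%R by apply: lt_0_INR; lia.
  by apply: frac_gt => //; nra.
case: Lin => [//|[x xr [_ low]]].
(* With [e1 <= L - 1] the lower bound [L - e1 / 2] exceeds 1, so the image gaps become long enough
   to contain a block beyond [I M]. *)
have [e1 [e10 [e1e e1L]]] : exists e1, (0 < e1 /\ e1 <= eps /\ e1 <= L - 1)%R.
  exists (Rmin eps (L - 1)); split; [apply: Rmin_glb_lt; lra | split; [exact: Rmin_l | exact: Rmin_r]].
pose K' := INR (K + K + I M + 3).
have [N NP] := large ((2 * L + 2) * (K' + 2) / (e1 / 2) )%R.
(* Asking for an index at least [N.+1] makes it a successor: [nonzero_gap_of_alive] applied to the
   [n]-th image speaks of the next one. *)
have [|[|n] [/leP nN rn]] := low (e1 / 2)%R _ N.+1; [lra | by [] |].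
have cx : consecutive u alive x.1 x.2 by move: xr; rewrite mem_filter => /andP[/asboolP].
have [p [q [cpq ps sp tq]]] := nonzero_gap_of_alive fixu posgt alive_stable sizeK nzE
  (consecutive_iter fixu posgt alive_stable n cx).
have sn := iter_last_image_ge fixu posgt alive_stable n.+1 cx.
move: rn; rewrite /rho /gap_ratio /=; rewrite /= in sn.
move: ps sp tq sn; set sN := phi _; set tN := psi _ => ps sp tq sn rn.
have big := NP _ (leq_trans (ltnW nN) sn).
have K'0 : (0 <= K')%R := pos_INR _.
have big1 : ((2 * L + 2) * (K' + 2) < INR sN * (e1 / 2))%R.
  have := Rmult_lt_compat_r (e1 / 2) _ _ ltac:(lra) big.
  by rewrite /Rdiv Rmult_assoc Rinv_l; lra.
have sN0 := pos_INR sN.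
have big2 : (K' + 2 < INR sN)%R by nra.
have r2 : ((L - e1 / 2) * (INR sN + 1) < INR tN + 1)%R.
  have := Rmult_lt_compat_r (INR sN + 1) _ _ ltac:(lra) rn.
  by rewrite /Rdiv [((_ * / _) * _)%R]Rmult_assoc Rinv_l; lra.
have INR_lt a b : (INR a < INR b)%R -> a < b by move=> h; apply/ltP; exact: INR_lt.
have pq : p.+1 < q.
  suff : sN + (K + K + I M + 3) < tN by lia.
  by apply: INR_lt; rewrite plus_INR -/K'; nra.
have sM : K + K + I M + 3 < sN by apply: INR_lt; rewrite -/K'; lra.
exists p.+1, q.-1; split; [lia | exact: consecutive_block |].
apply: frac_gt; first by apply: lt_0_INR; lia.
have h1 : (INR p.+1 <= INR sN + K')%R by rewrite -plus_INR; apply: leI; lia.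
have h2 : (INR tN <= INR q.-1 + K')%R by rewrite -plus_INR; apply: leI; lia.
have p0 := pos_INR p.+1.
have h3 : ((L - eps) * INR p.+1 <= (L - e1) * (INR sN + K'))%R by nra.
by nra.
Qed.

End ZeroBlocks.

End BlockLimsup.

(** * Limits along the orbit of one gap *)

Module RootLimsup.
Import all_boot all_order all_algebra zify.
Import ring Rstruct.
Import ExponentialPolynomials MorphismLengths LengthRatios AliveGaps BlockLimsup.
Set Implicit Arguments. Unset Strict Implicit. Unset Printing Implicit Defensive.
Import Order.TTheory GRing.Theory Num.Theory.
Local Open Scope nat_scope.
Local Notation R := Rdefinitions.R.

Lemma tends_shift (K : numFieldType) (f : nat -> K) l :
  tends (fun n => f n.+1) l -> tends f l.
Proof. by move=> fl e /fl[N NP]; exists N.+1; case=> // n; exact: NP. Qed.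

(** * Affine recurrences of the uniform case *)

Section UniformRecurrence.
Variables (T : finType) (q : nat) (next : T -> T).

(** The inhomogeneous term accumulated over [n] steps; it depends only on the starting letter, hence
    is periodic once the letters are. *)
Fixpoint increment (e : T -> nat) n c :=
  if n is n'.+1 then q * increment e n' c + e (iter n' next c) else 0.

Lemma recurrence_add (e : T -> nat) (l : nat -> T) (X : nat -> nat) :
  (forall n, l n.+1 = next (l n)) -> (forall n, X n.+1 = q * X n + e (l n)) ->
  forall m n, X (n + m) = q ^ m * X n + increment e m (l n).
Proof.
move=> lS XS m n; have ln k : l (n + k) = iter k next (l n).
  by elim: k => [|k IH]; rewrite ?addn0 // addnS lS IH.
elim: m => [|m IH]; first by rewrite addn0 mul1n addn0.
by rewrite addnS XS IH /= ln expnS; lia.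
Qed.

(** [P.-1 * Z + kap] is the distance to the fixed point of the affine map, cleared of its
    denominator; each step multiplies it by [P]. *)
Lemma affine_closed_form (P kap : nat) (Z : nat -> nat) : 0 < P ->
  (forall k, Z k.+1 = P * Z k + kap) ->
  forall k, P.-1 * Z k + kap = P ^ k * (P.-1 * Z 0 + kap).
Proof.
case: P => // P _ ZS; elim=> [|k IH]; first by rewrite mul1n.
by rewrite expnS -mulnA -IH ZS /=; lia.
Qed.

End UniformRecurrence.

Lemma affine_ratio_limit (P ka kb : nat) (X Y : nat -> nat) : 1 < P -> 0 < X 0 ->
  (forall k, X k.+1 = P * X k + ka) -> (forall k, Y k.+1 = P * Y k + kb) ->
  exists2 L : R, Defs.is_rational L &
    tends (fun k => (Y k).+1%:R / (X k).+1%:R : R)%R L.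
Proof.
move=> P1 X0 XS YS; have P0 := ltnW P1.
pose A := P.-1 * X 0 + ka; pose B := P.-1 * Y 0 + kb.
have A0 : 0 < A by rewrite /A; nia.
exists (B%:R / A%:R)%R.
  exists (BinInt.Z.of_nat B), (BinInt.Z.of_nat A); split; first by lia.
  by rewrite -!RIneq.INR_IZR_INZ !INRE RdivE.
have PR : (P%:R : R)%R != 0%R by rewrite pnatr_eq0 -lt0n.
have closed (kap : nat) (Z : nat -> nat) : (forall k, Z k.+1 = P * Z k + kap) ->
    tends (fun k => ((Z k).+1%:R * P.-1%:R) / P%:R ^+ k : R)%R (P.-1 * Z 0 + kap)%:R%R.
  move=> ZS.
  have g0 : tends (fun k => (P%:R^-1 : R) ^+ k)%R 0%R.
    apply: tends_geom; first by rewrite invr_ge0 ler0n.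
    by rewrite invf_lt1 ?ltr1n // ltr0n.
  have := tendsD (tends_cst ((P.-1 * Z 0 + kap)%:R : R)%R)
    (tends0Ml (P.-1%:R - kap%:R)%R g0).
  rewrite addr0; apply: (@tends_ext _ _ _ _ 0) => k _.
  have /(congr1 (fun n => n%:R : R)%R) := affine_closed_form P0 ZS k.
  rewrite natrD !natrM natrX => e.
  have -> : ((Z k).+1%:R * P.-1%:R = P%:R ^+ k * (P.-1 * Z 0 + kap)%:R + (P.-1%:R - kap%:R) :> R)%R.
    by rewrite -e -natr1; ring.
  rewrite exprVn; field.
  by rewrite expf_neq0.
have AR : (A%:R : R)%R != 0%R by rewrite pnatr_eq0 -lt0n.
have := tendsM (closed _ _ YS) (tends_inv AR (closed _ _ XS)).
apply: (@tends_ext _ _ _ _ 0) => k _; field.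
by rewrite nat1r !pnatr_eq0 expf_neq0 //= -lt0n -subn1 subn_gt0.
Qed.

(** The letters at both ends are eventually periodic, so along a residue class modulo [p] the
    recurrences become affine with constant terms. *)
Lemma uniform_ratio_limit (T : finType) (q : nat) (nextX nextY : T -> T) (eX eY : T -> nat)
    (lX lY : nat -> T) (X Y : nat -> nat) : 1 < q ->
  (forall n, lX n.+1 = nextX (lX n)) -> (forall n, lY n.+1 = nextY (lY n)) ->
  (forall n, X n.+1 = q * X n + eX (lX n)) -> (forall n, Y n.+1 = q * Y n + eY (lY n)) ->
  (forall n, n <= X n) ->
  exists2 p, 0 < p & forall r, exists2 L : R, Defs.is_rational L &
    tends (fun n => (Y (p * n + r)).+1%:R / (X (p * n + r)).+1%:R : R)%R L.
Proof.
move=> q1 lXS lYS XS YS Xn.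
have [pX pX0 pXP] := iter_idempotent nextX; have [pY pY0 pYP] := iter_idempotent nextY.
pose p := pX * pY; have p0 : 0 < p by rewrite muln_gt0 pX0.
have per (next : T -> T) (l : nat -> T) pl d : (forall n, l n.+1 = next (l n)) ->
    p = pl * d -> (forall x n, 0 < n -> iter (pl * n) next x = iter pl next x) ->
    forall r k, l (p * k.+1 + r) = l (p + r).
  move=> lS pE plP r k; have ln n : l n = iter n next (l 0) by elim: n => //= n <-.
  have d0 : 0 < d by move: p0; rewrite pE; lia.
  rewrite (ln (p * k.+1 + r)) (ln (p + r)) [in LHS]addnC [in RHS]addnC !iterD; congr iter.
  by rewrite pE -mulnA !plP // muln_gt0 d0.
exists p => // r.
have shift (f : nat -> nat) k : f (p * k.+2 + r) = f (p * k.+1 + r + p).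
  by congr f; rewrite mulnS; lia.
(* Indices start at [p * k.+1 + r] to be past the preperiod; [tends_shift] restores the first
   term. *)
have [||||L LQ LP] := @affine_ratio_limit (q ^ p) (increment q nextX eX p (lX (p + r)))
    (increment q nextY eY p (lY (p + r))) (fun k => X (p * k.+1 + r)) (fun k => Y (p * k.+1 + r)).
- by rewrite -(exp1n p) ltn_exp2r.
- by apply: leq_trans (Xn _); rewrite muln1; lia.
- move=> k; rewrite shift (recurrence_add lXS XS).
  by rewrite (per _ _ pX pY lXS erefl pXP).
- move=> k; rewrite shift (recurrence_add lYS YS).
  by rewrite (per _ _ pY pX lYS _ pYP) // /p mulnC.
by exists L => //; apply: tends_shift.
Qed.

(** * Prefixes with a marker at a gap end *)

Section RootRatios.
Variables (T : finType) (g : T -> seq T) (u : nat -> T).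
Hypothesis fixu : forall k, msub g (mkseq u k) = mkseq u (image_pos g u k).
Hypothesis posgt : forall k, 0 < k -> k < image_pos g u k.
Variable alive : pred T.
Hypothesis alive_stable : forall c, alive c = has alive (g c).

Definition marker_index (b : bool) c :=
  if b then rfind alive (g c) else find alive (g c).

(* A marker inr (b, c) stands at an end (the left one if b) of a gap, at a position carrying
   the letter c, and follows the prefix of u before that position. *)
Definition marked_morphism (x : T + bool * T) : seq (T + bool * T) :=
  match x with
  | inl c => map inl (g c)
  | inr (b, c) => rcons (map inl (take (marker_index b c) (g c)))
                        (inr (b, nth (u 0) (g c) (marker_index b c)))
  end.

Definition marked_prefix b s : seq (T + bool * T) :=
  rcons (map inl (mkseq u s)) (inr (b, u s)).

Definition marker_image b := if b then last_image g u alive else first_image g u alive.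

Lemma marker_index_lt b c : alive c -> marker_index b c < size (g c).
Proof.
rewrite alive_stable => h; case: b => /=; first by have [] := rfindP c h.
by rewrite -has_find.
Qed.

(** The prefix before [s] maps to the prefix before [image_pos s], and the marker contributes the
    letters of [g (u s)] up to the new marker. Positions plus one thus become lengths of iterated
    words. *)
Lemma marked_prefix_image b s : alive (u s) ->
  msub marked_morphism (marked_prefix b s) = marked_prefix b (marker_image b s).
Proof.
move=> /(marker_index_lt b) lt.
have -> : marker_image b s = image_pos g u s + marker_index b (u s) by case: b {lt}.
rewrite /marked_prefix -cats1 msub_cat {2}/msub /= cats0 (nth_image fixu) //.
rewrite -rcons_cat; congr rcons.
have -> : msub marked_morphism (map inl (mkseq u s)) = map inl (msub g (mkseq u s)).
  by rewrite /msub map_flatten -!map_comp.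
rewrite -map_cat; congr map; rewrite fixu.
have := fixu s.+1; rewrite -[in msub _ _]addn1 /mkseq iotaD map_cat msub_cat -/(mkseq u s) fixu.
rewrite {1}/msub /= cats0 => /(congr1 (take (image_pos g u s + marker_index b (u s)))).
rewrite take_cat size_mkseq ltnNge leq_addr addKn /= => ->.
rewrite -map_take take_iota (minn_idPl _) //.
by rewrite image_posS leq_add2l ltnW.
Qed.

Lemma marked_prefix_iter b s n :
  (forall k, alive (u (iter k (marker_image b) s))) ->
  iter n (msub marked_morphism) (marked_prefix b s) =
  marked_prefix b (iter n (marker_image b) s).
Proof. by move=> al; elim: n => //= n ->; rewrite marked_prefix_image. Qed.

Notation phi := (last_image g u alive).
Notation psi := (first_image g u alive).

Lemma root_limsup (Kp : R -> Prop) s t p : 0 < p ->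
  (forall r, exists2 L : R, Kp L & tends (fun n =>
     (iter (p * n + r) psi t).+1%:R / (iter (p * n + r) phi s).+1%:R : R)%R L) ->
  exists2 L, Kp L & Defs.is_limsup (gap_ratio g u alive s t) L.
Proof.
move=> p0 H; apply: (is_limsup_residues p0) => r; have [L KL LP] := H r.
exists L => //; apply/Un_cvP; apply: (@tends_ext _ _ _ _ 0) LP => n _.
by rewrite /gap_ratio RdivE !RplusE !INRE !natr1.
Qed.

Lemma algebraic_root_limsup s t : consecutive u alive s t ->
  exists2 L, Defs.is_algebraic L & Defs.is_limsup (gap_ratio g u alive s t) L.
Proof.
move=> c; have cn n := consecutive_iter fixu posgt alive_stable n c.
have sizeX n : size (iter n (msub marked_morphism) (marked_prefix true s)) = (iter n phi s).+1.
  rewrite marked_prefix_iter ?size_rcons ?size_map ?size_iota // => k.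
  by have [] := cn k.
have sizeY n : size (iter n (msub marked_morphism) (marked_prefix false t)) = (iter n psi t).+1.
  rewrite marked_prefix_iter ?size_rcons ?size_map ?size_iota // => k.
  by have [] := cn k.
have sizeK d : size (g d) <= \max_c size (g c) by exact: leq_bigmax.
have [|||p p0 pP] := @length_ratio_limit _ marked_morphism (marked_prefix true s)
  (marked_prefix false t) (\max_c size (g c)).+1.
- by move=> n; rewrite sizeX.
- by move=> n; rewrite sizeX sizeY; have [/ltnW] := cn n.
- move=> n; rewrite sizeX sizeY.
  by have := consecutive_le fixu posgt alive_stable sizeK (cn n); lia.
apply: (root_limsup p0) => r; have [L La LP] := pP r; exists L => //.
by apply: (@tends_ext _ _ _ _ 0) LP => n _; rewrite sizeX sizeY.
Qed.

Lemma rational_root_limsup q s t : 1 < q -> (forall c, size (g c) = q) ->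
  consecutive u alive s t ->
  exists2 L, Defs.is_rational L & Defs.is_limsup (gap_ratio g u alive s t) L.
Proof.
move=> q1 sizeq c; have cn n := consecutive_iter fixu posgt alive_stable n c.
have posE k : image_pos g u k = q * k.
  by elim: k => [|k IH]; rewrite ?muln0 // image_posS IH sizeq mulnS addnC.
pose next b c := nth (u 0) (g c) (marker_index b c).
have letter b x : alive (u x) -> u (marker_image b x) = next b (u x).
  move=> /(marker_index_lt b) lt; rewrite /next -(nth_image fixu) //.
  by case: (b).
have [p p0 pP] := @uniform_ratio_limit _ q (next true) (next false)
  (marker_index true) (marker_index false) (fun n => u (iter n phi s)) (fun n => u (iter n psi t))
  (fun n => iter n phi s) (fun n => iter n psi t) q1
  (fun n => letter true _ (let: And4 _ h _ _ := cn n in h))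
  (fun n => letter false _ (let: And4 _ _ h _ := cn n in h))
  (fun n => congr2 addn (posE _) erefl) (fun n => congr2 addn (posE _) erefl)
  (fun n => iter_last_image_ge fixu posgt alive_stable n c).
exact: root_limsup p0 pP.
Qed.

End RootRatios.

Lemma list_nthE (x0 : nat) s i : List.nth i s x0 = nth x0 s i.
Proof. by elim: s i => [|x s IH] [|i] /=. Qed.

Lemma list_lengthE (s : seq nat) : Datatypes.length s = size s.
Proof. by elim: s => //= x s ->. Qed.

(** * Restriction to a finite type and passage to a power *)

Section Convert.
Variables (m : nat) (h : nat -> seq nat).

(** [insub] discards letters outside ['I_m]; under [h_closed] none is lost. *)
Definition ord_morphism (c : 'I_m) : seq 'I_m := pmap insub (h c).

Hypothesis h_closed : Defs.is_morphism_on m h.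

Lemma ord_morphismE c : map val (ord_morphism c) = h c.
Proof.
rewrite /ord_morphism (pmap_filter (@insubK _ _ _)); apply/all_filterP.
have := h_closed (ssrnat.ltP (ltn_ord c)); elim: (h c) => //= d l IH /List.Forall_cons_iff[dm /IH ->].
by rewrite andbT; case: insubP => // /negP[]; apply/ssrnat.ltP.
Qed.

Lemma ord_morphism_iter n s :
  map val (iter n (msub ord_morphism) s) = Defs.morph_iter h n (map val s).
Proof.
elim: n => //= n IH; rewrite /Defs.morph_iter /= -/(Defs.morph_iter h n _) -IH.
elim: (iter n _ s) => //= c l IHl.
by rewrite /msub /= map_cat ord_morphismE [X in _ ++ X]IHl.
Qed.

Lemma prolongable_ord (a : 'I_m) : Defs.prolongable h (val a) ->
  exists x : seq 'I_m, ord_morphism a = a :: x /\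
    forall n, iter n (msub ord_morphism) x != [::].
Proof.
move=> [x [ha [_ xn]]]; have := ord_morphismE a; rewrite ha.
case E: (ord_morphism a) => [//|b y] /= [/val_inj ba yx].
exists y; rewrite ba; split=> // n.
apply/eqP => yn; case: (xn n); rewrite -yx.
by have := ord_morphism_iter n y; rewrite yn => <-.
Qed.

Lemma morphic_idempotent_power (a : 'I_m) (u : nat -> nat) : Defs.prolongable h (val a) ->
  Defs.is_fixed_point_word h (val a) u ->
  exists p (v : nat -> 'I_m), let g := mpow ord_morphism p in
  [/\ 0 < p, forall k, u k = v k :> nat,
    forall k, msub g (mkseq v k) = mkseq v (image_pos g v k),
    forall k, 0 < k -> k < image_pos g v k &
    forall c d, (d \in msub g (g c)) = (d \in g c)].
Proof.
move=> pro fixp; have [x [ax xn]] := prolongable_ord pro.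
set f := msub ord_morphism in xn.
pose H n := iter n f [:: a].
have HS n : H n.+1 = H n ++ iter n f x.
  have f1 : f [:: a] = [:: a] ++ x by rewrite /f /msub /= cats0.
  by rewrite /H iterSr f1 iter_msub_cat.
have Hn n : n < size (H n).
  elim: n => // n IH; rewrite HS size_cat -addn1; apply: leq_add => //.
  by rewrite lt0n size_eq0.
pose v k := nth a (H k) k.
have Huv n i : i < size (H n) -> u i = val (nth a (H n) i).
  have e : Defs.morph_iter h n [:: val a] = map val (H n) by rewrite /H ord_morphism_iter.
  move=> lt; rewrite (fixp n i) e ?list_nthE ?(nth_map a) //.
  by rewrite list_lengthE size_map; apply/ssrnat.ltP.
have uv k : u k = val (v k) by apply: Huv.
have HE n : H n = mkseq v (size (H n)).
  apply: (@eq_from_nth _ a); rewrite ?size_mkseq // => i lt.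
  by rewrite nth_mkseq //; apply: val_inj; rewrite -uv -Huv.
have [p p0 pP] := mpow_idempotent ord_morphism.
exists p, v; set g := mpow _ p in pP *; rewrite /=.
have gH n : iter n (msub g) [:: a] = H (p * n) by rewrite iter_mpow.
(* [g (mkseq v k)] is a prefix of [g (H (p * k))], that is of [H (p * k.+1)], itself a prefix of
   [v]. *)
have fixv k : msub g (mkseq v k) = mkseq v (image_pos g v k).
  have lt : k <= size (H (p * k)).
    by apply: ltnW; apply: leq_trans (Hn _); rewrite ltnS leq_pmull.
  have e : mkseq v (size (H (p * k.+1))) =
      msub g (mkseq v k) ++ msub g (drop k (H (p * k))).
    rewrite -HE -gH iterS gH -msub_cat; congr msub.
    rewrite -[LHS](cat_take_drop k) {1}HE /mkseq -map_take take_iota.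
    by rewrite (minn_idPl lt).
  have := congr1 (take (image_pos g v k)) e; rewrite take_size_cat // => <-.
  rewrite /mkseq -map_take take_iota (minn_idPl _) //.
  by have := congr1 size e; rewrite size_mkseq size_cat => ->; rewrite leq_addr.
split=> // k k0; rewrite ltnNge; apply/negP => pk.
(* If the prefix of length [k] had an image of length at most [k], all iterates of shorter prefixes
   would stay within length [k], whereas [H] is unbounded. *)
have bnd n l : l <= k -> size (iter n (msub g) (mkseq v l)) <= k.
  elim: n l => [|n IH] l lk; first by rewrite size_mkseq.
  by rewrite iterSr fixv; apply: IH; apply: leq_trans (image_pos_le _ _ lk) pk.
have := bnd k 1 k0; have -> : mkseq v 1 = [:: a] by [].
rewrite gH leqNgt => /negP; apply; apply: leq_trans (Hn _); rewrite ltnS leq_pmull //.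
Qed.

End Convert.

End RootLimsup.

(** * Morphic and automatic words *)

Module Coding.
Import all_boot zify.
Import MorphismLengths LengthRatios AliveGaps BlockLimsup RootLimsup.
Import Defs Reals Lra.
Set Implicit Arguments. Unset Strict Implicit. Unset Printing Implicit Defensive.
Local Open Scope nat_scope.

(** [Kp] stands for rationality or algebraicity; only the analysis of a single gap orbit differs
    between the two cases. *)
Lemma coded_limsup (Kp : R -> Prop) m (h : nat -> seq nat) (a : 'I_m) u tau w :
  Kp 1%R -> is_morphism_on m h -> prolongable h a -> is_fixed_point_word h a u ->
  (forall k, w k = tau (u k)) ->
  (forall p (v : nat -> 'I_m) alive, let g := mpow (ord_morphism h) p in
     0 < p -> (forall k, msub g (mkseq v k) = mkseq v (image_pos g v k)) ->
     (forall k, 0 < k -> k < image_pos g v k) -> (forall c, alive c = has alive (g c)) ->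
     forall s t, consecutive v alive s t ->
     exists2 L, Kp L & is_limsup (gap_ratio g v alive s t) L) ->
  infinitely_many_max_zero_blocks w ->
  forall I J, enumerates_max_zero_blocks w I J ->
  exists L, is_limsup (fun k => INR (J k) / INR (I k))%R L /\ Kp L.
Proof.
move=> K1 hm pro fixp wE root infw I J enum.
have [p [v [p0 uv fixv posv idem]]] := morphic_idempotent_power hm pro fixp.
set g := mpow _ p in fixv posv idem.
pose nz (c : 'I_m) := tau c != 0; pose alive c := has nz (g c).
(* [g (g c)] and [g c] have the same letters, so looking for a nonzero digit one step later changes
   nothing. *)
have stable c : alive c = has alive (g c).
  apply/hasP/hasP => [[d]|[e ec /hasP[d de nd]]].
    rewrite -idem => /flatten_mapP[e ec de] nd; exists e => //.
    by apply/hasP; exists d.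
  by exists d => //; rewrite -idem; apply/flatten_mapP; exists e.
have wv k : nz (v k) = (w k != 0) by rewrite wE uv.
exact: (limsup_zero_blocks fixv posv stable (fun c => erefl) wv K1 (root p v alive p0 fixv posv stable)).
Qed.

Lemma automatic_limsup w : automatic w -> infinitely_many_max_zero_blocks w ->
  forall I J, enumerates_max_zero_blocks w I J ->
  exists L, is_limsup (fun k => INR (J k) / INR (I k))%R L /\ is_rational L.
Proof.
move=> [m [h [a [u [tau [/ltP am [hm [[q hq] [pro [fixp wE]]]]]]]]]].
have q1 : 1 < q.
  have [[|y x] [ha [x0 _]]] := pro; first by case: x0.
  by have := hq a (ltP am); rewrite ha => <-.
apply: (@coded_limsup _ m h (Ordinal am) u tau) => //.
  by exists 1%Z, 1%Z; split=> //; lra.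
move=> p v alive g p0 fixv posv stable s t.
have sizeq (c : 'I_m) : size (ord_morphism h c) = q.
  by rewrite -(size_map val) ord_morphismE // -list_lengthE hq //; apply/ltP.
apply: (@rational_root_limsup _ _ _ fixv posv _ stable (expn q p)).
  by rewrite -(exp1n p) ltn_exp2r.
move=> c; rewrite /g /mpow; elim: (p) => // k IH.
rewrite iterS expnS -IH; elim: (iter k _ _) => [|d l IHl]; first by rewrite muln0.
by rewrite /msub /= size_cat [size (flatten _)]IHl sizeq mulnS.
Qed.

Lemma morphic_limsup w : morphic w -> infinitely_many_max_zero_blocks w ->
  forall I J, enumerates_max_zero_blocks w I J ->
  exists L, is_limsup (fun k => INR (J k) / INR (I k))%R L /\ is_algebraic L.
Proof.
move=> [m [h [a [u [tau [/ltP am [hm [pro [fixp wE]]]]]]]]].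
apply: (@coded_limsup _ m h (Ordinal am) u tau) => //.
  exists [:: 1%Z; (-1)%Z]; split; first by apply: List.Exists_cons_hd.
  by rewrite /zpoly_eval /=; lra.
move=> p v alive g p0 fixv posv stable s t.
exact: algebraic_root_limsup fixv posv _ stable _ _.
Qed.

End Coding.

Require Import Defs.
From Stdlib Require Import Reals ZArith List Arith.
Open Scope R_scope.

Theorem theorem4 :
  (forall (b : nat) (w : nat -> nat), (2 <= b)%nat -> word_over b w -> automatic w ->
     no_zero_tail w -> infinitely_many_max_zero_blocks w ->
     forall I J : nat -> nat, enumerates_max_zero_blocks w I J ->
     exists L : R, is_limsup (fun k => INR (J k) / INR (I k)) L /\ is_rational L)
  /\
  (forall (b : nat) (w : nat -> nat), (2 <= b)%nat -> word_over b w -> morphic w ->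
     no_zero_tail w -> infinitely_many_max_zero_blocks w ->
     forall I J : nat -> nat, enumerates_max_zero_blocks w I J ->
     exists L : R, is_limsup (fun k => INR (J k) / INR (I k)) L /\ is_algebraic L).
Proof.
split; intros b w _ _ wdef _ infw I J enum.
- exact (Coding.automatic_limsup wdef infw enum).
- exact (Coding.morphic_limsup wdef infw enum).
Qed.
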